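(* Let $\gamma\ge1$ and let $(\rho,u,v)$ ($\rho>0$) be a local analytic solution in space-time of the compressible Euler equations $$\partial_t(\rho u)+\partial_1(\rho u^2+p)+\partial_2(\rho uv)=0,\quad \partial_t(\rho v)+\partial_1(\rho uv)+\partial_2(\rho v^2+p)=0,\quad \partial_t\rho+\partial_1(\rho u)+\partial_2(\rho v)=0,\quad p=\frac{\rho^\gamma}{\gamma},$$ satisfying the initial condition $\rho uv\neq0$ at a point $x_0$. Then there is an evolving metric $\mathbf g$ (locally near $x_0$ and for small $t\ge 0$) so that the solution $(\rho,u,v)$ also defines a time evolving two-dimensional Riemannian manifold $(\mathcal M,\mathbf g)$ immersed in $\mathbb R^3$, with Gauss curvature $\kappa$ determined by $$\kappa=\frac{\rho^{2\gamma}}{\gamma^2}+(u^2+v^2)\frac{\rho^{\gamma+1}}{\gamma}.$$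
   Context: ''$(\rho,u,v)$ defines a time evolving Riemannian manifold $(\mathcal M,\mathbf g)$ immersed in $\mathbb R^3$'' means that $L=\rho v^2+p$, $M=-\rho uv$, $N=\rho u^2+p$ satisfy at each time the Gauss–Codazzi equations $$\partial_1N-\partial_2M=-\Gamma^1_{22}L+2\Gamma^1_{12}M-\Gamma^1_{11}N,\quad \partial_1M-\partial_2L=\Gamma^2_{22}L-2\Gamma^2_{12}M+\Gamma^2_{11}N,\quad LN-M^2=\kappa,$$ where $\Gamma^k_{ij}$ and $\kappa$ are the Christoffel symbols and Gauss curvature of $\mathbf g(\cdot,t)$; equivalently there is locally an immersion $\mathbf y(t,\cdot)$ into $\mathbb R^3$ with $\partial_i\mathbf y\cdot\partial_j\mathbf y=g_{ij}$ and second fundamental form divided by $\sqrt{\det\mathbf g}$ equal to $(L,M,N)$. *)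

(* Defs.v *)
From Stdlib Require Import Reals.
From Coquelicot Require Import Coquelicot.
Open Scope R_scope.

(** Functions of [(t, x1, x2)]; regions of space-time are predicates on
    [R * R * R], so that Coquelicot's topology applies to them. *)
Definition field := R -> R -> R -> R.
Definition region := R * R * R -> Prop.

Inductive idx := i1 | i2.

Definition sum_idx (F : idx -> R) : R := F i1 + F i2.

(** [Derive] is total (it is unspecified where [f] is not differentiable); the
    partial derivatives below are only used on analytic or smooth fields. *)
Definition pd_t (f : field) : field :=
  fun t x1 x2 => Derive (fun s => f s x1 x2) t.

Definition pd (i : idx) (f : field) : field :=
  match i with
  | i1 => fun t x1 x2 => Derive (fun s => f t s x2) x1
  | i2 => fun t x1 x2 => Derive (fun s => f t x1 s) x2
  end.

(** The sum of [F i j k] over [i + j + k = n]. *)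
Definition sum_degree (n : nat) (F : nat -> nat -> nat -> R) : R :=
  sum_n (fun i => sum_n (fun j => F i j (n - i - j)%nat) (n - i)) n.

(** Convergence of a power series in three variables is absolute convergence;
    grouping the monomials by total degree then does not affect the sum. *)
Definition analytic_at (f : field) (t x1 x2 : R) : Prop :=
  exists (c : nat -> nat -> nat -> R) (r : R), 0 < r /\
    forall h k l : R, Rabs h < r -> Rabs k < r -> Rabs l < r ->
      ex_series (fun n =>
        sum_degree n (fun i j m => Rabs (c i j m * h ^ i * k ^ j * l ^ m))) /\
      is_series (fun n =>
        sum_degree n (fun i j m => c i j m * h ^ i * k ^ j * l ^ m))
        (f (t + h) (x1 + k) (x2 + l)).

Definition analytic_on (U : region) (f : field) : Prop :=
  forall t x1 x2, U (t, x1, x2) -> analytic_at f t x1 x2.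

(** Class C^n on an open region, jointly in time and space. *)
Fixpoint Cn_on (n : nat) (U : region) (f : field) : Prop :=
  (forall t x1 x2, U (t, x1, x2) ->
     continuous (fun q : R * R * R => f (fst (fst q)) (snd (fst q)) (snd q))
       (t, x1, x2)) /\
  match n with
  | O => True
  | S m =>
      (forall t x1 x2, U (t, x1, x2) ->
         ex_derive (fun s => f s x1 x2) t /\
         ex_derive (fun s => f t s x2) x1 /\
         ex_derive (fun s => f t x1 s) x2) /\
      Cn_on m U (pd_t f) /\ Cn_on m U (pd i1 f) /\ Cn_on m U (pd i2 f)
  end.

Definition smooth_on (U : region) (f : field) : Prop :=
  forall n, Cn_on n U f.

Definition pressure (gamma : R) (rho : field) : field :=
  fun t x1 x2 => Rpower (rho t x1 x2) gamma / gamma.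

(** The time domain is [0 <= t]. Analyticity at the points with [t = 0] is that
    of a two-sided neighbourhood, so the time derivative makes sense there. *)
Definition analytic_euler_solution
    (gamma : R) (U : region) (rho u v : field) : Prop :=
  let p := pressure gamma rho in
  analytic_on U rho /\ analytic_on U u /\ analytic_on U v /\
  forall t x1 x2, U (t, x1, x2) -> 0 <= t ->
    0 < rho t x1 x2 /\
    pd_t (fun t x1 x2 => rho t x1 x2 * u t x1 x2) t x1 x2
    + pd i1 (fun t x1 x2 => rho t x1 x2 * u t x1 x2 ^ 2 + p t x1 x2) t x1 x2
    + pd i2 (fun t x1 x2 => rho t x1 x2 * u t x1 x2 * v t x1 x2) t x1 x2 = 0 /\
    pd_t (fun t x1 x2 => rho t x1 x2 * v t x1 x2) t x1 x2
    + pd i1 (fun t x1 x2 => rho t x1 x2 * u t x1 x2 * v t x1 x2) t x1 x2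
    + pd i2 (fun t x1 x2 => rho t x1 x2 * v t x1 x2 ^ 2 + p t x1 x2) t x1 x2
      = 0 /\
    pd_t rho t x1 x2
    + pd i1 (fun t x1 x2 => rho t x1 x2 * u t x1 x2) t x1 x2
    + pd i2 (fun t x1 x2 => rho t x1 x2 * v t x1 x2) t x1 x2 = 0.

(** [g i j] is the component of the metric in the coordinates [(x1, x2)]. *)
Definition metric := idx -> idx -> field.

Definition evolving_metric (V : region) (g : metric) : Prop :=
  (forall i j, smooth_on V (g i j)) /\
  forall t x1 x2, V (t, x1, x2) ->
    (forall i j, g i j t x1 x2 = g j i t x1 x2) /\
    (forall w : idx -> R, (exists i, w i <> 0) ->
       0 < sum_idx (fun i => sum_idx (fun j => g i j t x1 x2 * w i * w j))).

Definition det_metric (g : metric) : field :=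
  fun t x1 x2 =>
    g i1 i1 t x1 x2 * g i2 i2 t x1 x2 - g i1 i2 t x1 x2 * g i2 i1 t x1 x2.

Definition inv_metric (g : metric) : metric :=
  fun i j t x1 x2 =>
    match i, j with
    | i1, i1 => g i2 i2 t x1 x2
    | i2, i2 => g i1 i1 t x1 x2
    | _, _ => - g i j t x1 x2
    end / det_metric g t x1 x2.

(** [christoffel g k i j] is Gamma^k_{ij}. *)
Definition christoffel (g : metric) (k i j : idx) : field :=
  fun t x1 x2 =>
    / 2 * sum_idx (fun l => inv_metric g k l t x1 x2 *
      (pd i (g j l) t x1 x2 + pd j (g i l) t x1 x2 - pd l (g i j) t x1 x2)).

(** [riemann g l i j k] is the [l]-th component of R(d_i, d_j) d_k, where
    R(X, Y) = [nabla_X, nabla_Y] - nabla_[X, Y]. *)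
Definition riemann (g : metric) (l i j k : idx) : field :=
  fun t x1 x2 =>
    pd i (christoffel g l j k) t x1 x2 - pd j (christoffel g l i k) t x1 x2
    + sum_idx (fun m =>
        christoffel g l i m t x1 x2 * christoffel g m j k t x1 x2
        - christoffel g l j m t x1 x2 * christoffel g m i k t x1 x2).

(** <R(d_1, d_2) d_2, d_1> / det g, which is positive on a round sphere. *)
Definition gauss_curvature (g : metric) : field :=
  fun t x1 x2 =>
    sum_idx (fun l => g i1 l t x1 x2 * riemann g l i1 i2 i2 t x1 x2)
    / det_metric g t x1 x2.

(** [L], [M], [N] are the coefficients of the second fundamental form divided by
    [sqrt (det g)], so the Gauss equation has no factor [det g]. *)
Definition gauss_codazzi_at
    (g : metric) (L M N : field) (t x1 x2 : R) : Prop :=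
  let Gam k i j := christoffel g k i j t x1 x2 in
  pd i1 N t x1 x2 - pd i2 M t x1 x2
    = - Gam i1 i2 i2 * L t x1 x2 + 2 * Gam i1 i1 i2 * M t x1 x2
      - Gam i1 i1 i1 * N t x1 x2 /\
  pd i1 M t x1 x2 - pd i2 L t x1 x2
    = Gam i2 i2 i2 * L t x1 x2 - 2 * Gam i2 i1 i2 * M t x1 x2
      + Gam i2 i1 i1 * N t x1 x2 /\
  L t x1 x2 * N t x1 x2 - M t x1 x2 ^ 2 = gauss_curvature g t x1 x2.

Definition fluid_L (gamma : R) (rho v : field) : field :=
  fun t x1 x2 => rho t x1 x2 * v t x1 x2 ^ 2 + pressure gamma rho t x1 x2.

Definition fluid_M (rho u v : field) : field :=
  fun t x1 x2 => - (rho t x1 x2 * u t x1 x2 * v t x1 x2).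

Definition fluid_N (gamma : R) (rho u : field) : field :=
  fun t x1 x2 => rho t x1 x2 * u t x1 x2 ^ 2 + pressure gamma rho t x1 x2.

Definition defines_immersed_evolving_manifold
    (gamma : R) (V : region) (rho u v : field) (g : metric) : Prop :=
  evolving_metric V g /\
  forall t x1 x2, V (t, x1, x2) -> 0 <= t ->
    gauss_codazzi_at g (fluid_L gamma rho v) (fluid_M rho u v)
      (fluid_N gamma rho u) t x1 x2.

(* Main.v *)
Require Import Defs.
From Stdlib Require Import Reals Factorial Lra Lia List FunctionalExtensionality.
From Coquelicot Require Import Coquelicot.
Open Scope R_scope.

(** At each time the three coordinates of a surface in space with normal
    direction [(a, b, 1)] and second fundamental form [(L, M, N)] (divided by
    [sqrt (det g)]) can be recovered from the first two, [X] and [Y], and the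
    unknowns satisfy
      [a_1 = (M a_2 - (L N - M^2) (1 + a^2 + b^2) Y_2) / N],
      [b_1 = (M b_2 + (L N - M^2) (1 + a^2 + b^2) X_2) / N],
      [X_1 = (M X_2 - b_2 / (1 + a^2 + b^2)) / N],
      [Y_1 = (M Y_2 + a_2 / (1 + a^2 + b^2)) / N].
    Since [N > 0], the lines [x1 = const] are not characteristic, and for analytic
    [L, M, N], depending analytically on [t], a solution with Cauchy data
    [a = x2 - a2], [X = a2 - x2], [b = Y = 0] on [x1 = a1] is found by the method
    of majorants; its first fundamental form is the metric. The pressure, [1 / N]
    and [1 / (1 + a^2 + b^2)] are adjoined as further unknowns to make the system
    polynomial: they solve ordinary differential equations along the coordinate
    lines.

    Power series are represented by the derivatives at the origin, so that
    differentiation is an index shift and products obey the Leibniz rule. *)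

(** * Jets *)

(** Every surface satisfies the Gauss and Codazzi equations, so it is enough to build one with the
    prescribed second fundamental form instead of solving for the metric. Orthogonality to
    [(a, b, 1)] forces the third components [-(a X_i + b Y_i)] of the tangents; differentiating it,
    the second fundamental form is prescribed by [-(a_j X_i + b_j Y_i) = h_ij J w] with
    [J = X_1 Y_2 - Y_1 X_2] and [w = 1 + a^2 + b^2]. Solving for the [x1]-derivatives gives the
    system, and then [J = - D / (N w)] with [D = a_2 X_2 + b_2 Y_2]. The surface is regular where
    [D] is nonzero; the Cauchy data make [D = -1] at the centre.

    The obstacle to the majorant estimate is that the [x1]-equations contain [x2]-derivatives of the
    same order. Hence two slopes: [A] for [t] and [x2] is fixed first, and [K] for [x1] is then
    taken large in terms of [A].

    Each Taylor coefficient is read off a single equation, so there are no compatibility conditions;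
    in return the [x2]- and [t]-equations hold only where [x1 = a1], respectively where [x1 = a1]
    and [x2 = a2]. *)

Definition jet := nat -> nat -> nat -> R.

Inductive axis := axt | ax1 | ax2.

Definition shift (e : axis) (f : jet) : jet :=
  match e with
  | axt => fun i j k => f (S i) j k
  | ax1 => fun i j k => f i (S j) k
  | ax2 => fun i j k => f i j (S k)
  end.

Definition jadd (f g : jet) : jet := fun i j k => f i j k + g i j k.
Definition jscal (c : R) (f : jet) : jet := fun i j k => c * f i j k.
Definition jconst (c : R) : jet :=
  fun i j k => match i, j, k with O, O, O => c | _, _, _ => 0 end.

(** The product is the one forced by the Leibniz rule, unfolded first in [t], then in [x1], then in
    [x2]; no binomial coefficients appear. *)
Fixpoint jmul2 (f g : jet) (k : nat) : R :=
  match k with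
  | O => f O O O * g O O O
  | S k' => jmul2 (shift ax2 f) g k' + jmul2 f (shift ax2 g) k'
  end.

Fixpoint jmul1 (f g : jet) (j k : nat) : R :=
  match j with
  | O => jmul2 f g k
  | S j' => jmul1 (shift ax1 f) g j' k + jmul1 f (shift ax1 g) j' k
  end.

Fixpoint jmul (f g : jet) (i j k : nat) : R :=
  match i with
  | O => jmul1 f g j k
  | S i' => jmul (shift axt f) g i' j k + jmul f (shift axt g) i' j k
  end.

Lemma jet_ext (f g : jet) : (forall i j k, f i j k = g i j k) -> f = g.
Proof.
intros H. do 3 (apply functional_extensionality; intro). apply H.
Qed.

Lemma shift_comm (e e' : axis) (f : jet) :
  shift e (shift e' f) = shift e' (shift e f).
Proof. destruct e, e'; reflexivity. Qed.

Lemma shift_jadd (e : axis) (f g : jet) :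
  shift e (jadd f g) = jadd (shift e f) (shift e g).
Proof. destruct e; reflexivity. Qed.

Lemma shift_jscal (e : axis) (c : R) (f : jet) :
  shift e (jscal c f) = jscal c (shift e f).
Proof. destruct e; reflexivity. Qed.

Lemma shift_jconst (e : axis) (c : R) : shift e (jconst c) = jconst 0.
Proof.
apply jet_ext; intros i j k; destruct e, i, j, k; reflexivity.
Qed.

#[local] Arguments shift : simpl never.

(** Definitional for [axt]; for the other axes the shift is moved past the outer recursions, since
    shifts commute. *)
Lemma shift_jmul (e : axis) (f g : jet) :
  shift e (jmul f g) = jadd (jmul (shift e f) g) (jmul f (shift e g)).
Proof.
apply jet_ext; intros i j k; unfold jadd; destruct e;
  unfold shift at 1; simpl.
- reflexivity.
- revert f g; induction i as [|i IH]; intros f g; simpl; [reflexivity|].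
  rewrite !IH, !(shift_comm ax1 axt). ring.
- revert f g; induction i as [|i IH]; intros f g; simpl.
  + revert f g; induction j as [|j IH]; intros f g; simpl; [reflexivity|].
    rewrite !IH, !(shift_comm ax2 ax1). ring.
  + rewrite !IH, !(shift_comm ax2 axt). ring.
Qed.

Lemma jmul_addl (f f' g : jet) :
  jmul (jadd f f') g = jadd (jmul f g) (jmul f' g).
Proof.
apply jet_ext; intros i j k; unfold jadd at 2; revert j k f f' g.
induction i as [|i IHi]; intros j k f f' g; simpl.
- revert k f f' g. induction j as [|j IHj]; intros k f f' g; simpl.
  + revert f f' g. induction k as [|k IHk]; intros f f' g; simpl.
    * unfold jadd; ring.
    * rewrite shift_jadd, !IHk. ring.
  + rewrite shift_jadd, !IHj. ring.
- rewrite shift_jadd, !IHi. ring.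
Qed.

Lemma jmul_comm (f g : jet) : jmul f g = jmul g f.
Proof.
apply jet_ext; intros i j k; revert j k f g.
induction i as [|i IHi]; intros j k f g; simpl.
- revert k f g. induction j as [|j IHj]; intros k f g; simpl.
  + revert f g. induction k as [|k IHk]; intros f g; simpl.
    * ring.
    * rewrite (IHk _ g), (IHk f). ring.
  + rewrite (IHj k _ g), (IHj k f). ring.
- rewrite (IHi j k _ g), (IHi j k f). ring.
Qed.

Lemma jmul_scall (c : R) (f g : jet) :
  jmul (jscal c f) g = jscal c (jmul f g).
Proof.
apply jet_ext; intros i j k; unfold jscal at 2; revert j k f g.
induction i as [|i IHi]; intros j k f g; simpl.
- revert k f g. induction j as [|j IHj]; intros k f g; simpl.
  + revert f g. induction k as [|k IHk]; intros f g; simpl.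
    * unfold jscal; ring.
    * rewrite shift_jscal, !IHk. ring.
  + rewrite shift_jscal, !IHj. ring.
- rewrite shift_jscal, !IHi. ring.
Qed.

Lemma jmul_addr (f g g' : jet) :
  jmul f (jadd g g') = jadd (jmul f g) (jmul f g').
Proof. rewrite !(jmul_comm f). apply jmul_addl. Qed.

Lemma jmul_scalr (c : R) (f g : jet) :
  jmul f (jscal c g) = jscal c (jmul f g).
Proof. rewrite !(jmul_comm f). apply jmul_scall. Qed.

(** This locality is what makes the recursion for the jets of the solution well founded. *)
Lemma jmul_local (f f' g g' : jet) i j k :
  (forall a b c, (a <= i)%nat -> (b <= j)%nat -> (c <= k)%nat ->
     f a b c = f' a b c /\ g a b c = g' a b c) ->
  jmul f g i j k = jmul f' g' i j k.
Proof.
revert j k f f' g g'.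
induction i as [|i IHi]; intros j k f f' g g' H.
- simpl. revert k f f' g g' H.
  induction j as [|j IHj]; intros k f f' g g' H.
  + simpl. revert f f' g g' H.
    induction k as [|k IHk]; intros f f' g g' H; simpl.
    * destruct (H 0 0 0)%nat as [-> ->]; auto.
    * f_equal; apply IHk; intros a b c Ha Hb Hc;
        unfold shift; split; apply H; lia.
  + simpl. f_equal; apply IHj; intros a b c Ha Hb Hc; unfold shift; split; apply H; lia.
- simpl. f_equal; apply IHi; intros a b c Ha Hb Hc; unfold shift; split; apply H; lia.
Qed.

(** * Majorants of jets *)

Lemma PS_mult_derive (a b : nat -> R) (n : nat) :
  PS_mult (PS_derive a) b n + PS_mult a (PS_derive b) n
  = INR (S n) * PS_mult a b (S n).
Proof.
unfold PS_mult, PS_derive.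
set (G := fun k => a k * b (S n - k)%nat).
assert (E : INR (S n) * sum_f_R0 G (S n)
  = sum_f_R0 (fun k => INR k * G k) (S n)
    + sum_f_R0 (fun k => INR (S n - k) * G k) (S n)).
{ rewrite scal_sum, <- sum_plus. apply sum_eq. intros k Hk.
  rewrite minus_INR by lia. ring. }
rewrite E; clear E. f_equal.
- rewrite (decomp_sum _ (S n)) by lia. simpl pred. simpl (INR 0).
  rewrite Rmult_0_l, Rplus_0_l. apply sum_eq. intros k Hk. unfold G.
  replace (S n - S k)%nat with (n - k)%nat by lia. ring.
- rewrite tech5. replace (S n - S n)%nat with 0%nat by lia.
  simpl (INR 0). rewrite Rmult_0_l, Rplus_0_r. apply sum_eq.
  intros k Hk. unfold G. replace (S n - k)%nat with (S (n - k)) by lia. ring.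
Qed.

(** [maj c A K phi f]: the jet [f] is dominated by the jet of the function
    [c * Phi (A t + K x1 + A x2)], where [Phi] has Taylor coefficients [phi]. *)
Definition maj (c A K : R) (phi : nat -> R) (f : jet) : Prop :=
  forall i j k, Rabs (f i j k)
    <= c * A ^ (i + k) * K ^ j * (INR (fact (i + j + k)) * phi (i + j + k)%nat).

Lemma fact_derive (phi : nat -> R) n :
  INR (fact (S n)) * phi (S n) = INR (fact n) * PS_derive phi n.
Proof. unfold PS_derive. rewrite fact_simpl, mult_INR. ring. Qed.

Lemma maj_shift (e : axis) c A K phi f :
  maj c A K phi f ->
  maj (c * match e with ax1 => K | _ => A end) A K (PS_derive phi) (shift e f).
Proof.
intros H i j k. rewrite <- fact_derive.
destruct e; unfold shift.
- eapply Rle_trans; [apply H|]. right. simpl (S i + _)%nat. simpl. ring.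
- eapply Rle_trans; [apply H|]. right.
  replace (i + S j + k)%nat with (S (i + j + k)) by lia. simpl. ring.
- eapply Rle_trans; [apply H|]. right.
  replace (i + j + S k)%nat with (S (i + j + k)) by lia.
  replace (i + S k)%nat with (S (i + k)) by lia. simpl. ring.
Qed.

(** Jets and one-variable majorants obey the same Leibniz rule ([shift_jmul], [PS_mult_derive]), so
    the induction closes with exactly the constant [c * c']. *)
Lemma maj_jmul c c' A K phi psi f g :
  maj c A K phi f -> maj c' A K psi g ->
  maj (c * c') A K (PS_mult phi psi) (jmul f g).
Proof.
assert (step : forall (e : axis) i j k c c' phi psi f g,
  let m := match e with ax1 => K | _ => A end in
  Rabs (jmul (shift e f) g i j k)
    <= (c * m * c') * A ^ (i + k) * K ^ j *
       (INR (fact (i + j + k)) * PS_mult (PS_derive phi) psi (i + j + k)%nat) ->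
  Rabs (jmul f (shift e g) i j k)
    <= (c * (c' * m)) * A ^ (i + k) * K ^ j *
       (INR (fact (i + j + k)) * PS_mult phi (PS_derive psi) (i + j + k)%nat) ->
  Rabs (jmul (shift e f) g i j k + jmul f (shift e g) i j k)
    <= (c * c') * (m * (A ^ (i + k) * K ^ j)) *
       (INR (fact (S (i + j + k))) * PS_mult phi psi (S (i + j + k)))).
{ clear. intros e i j k c c' phi psi f g m H1 H2.
  eapply Rle_trans; [apply Rabs_triang|].
  eapply Rle_trans; [apply Rplus_le_compat; [exact H1|exact H2]|].
  right. rewrite fact_simpl, mult_INR.
  transitivity (c * c' * (m * (A ^ (i + k) * K ^ j)) * INR (fact (i + j + k)) *
    (PS_mult (PS_derive phi) psi (i + j + k)%nat
     + PS_mult phi (PS_derive psi) (i + j + k)%nat)).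
  - ring.
  - rewrite PS_mult_derive. ring. }
intros Hf Hg i j k. revert j k c c' phi psi f g Hf Hg.
induction i as [|i IHi]; intros j k c c' phi psi f g Hf Hg.
- revert k c c' phi psi f g Hf Hg.
  induction j as [|j IHj]; intros k c c' phi psi f g Hf Hg.
  + revert c c' phi psi f g Hf Hg.
    induction k as [|k IHk]; intros c c' phi psi f g Hf Hg.
    * simpl. unfold PS_mult. simpl. rewrite Rabs_mult.
      specialize (Hf 0 0 0)%nat. specialize (Hg 0 0 0)%nat.
      simpl in Hf, Hg.
      eapply Rle_trans.
      { apply Rmult_le_compat; [apply Rabs_pos|apply Rabs_pos|exact Hf|exact Hg]. }
      right. ring.
    * change (jmul f g 0 0 (S k)) with
        (jmul (shift ax2 f) g 0 0 k + jmul f (shift ax2 g) 0 0 k).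
      eapply Rle_trans; [apply (step ax2 0%nat 0%nat k c c' phi psi)|].
      -- apply IHk; [apply (maj_shift ax2), Hf|exact Hg].
      -- apply IHk; [exact Hf|apply (maj_shift ax2), Hg].
      -- right. simpl. ring.
  + change (jmul f g 0 (S j) k) with
      (jmul (shift ax1 f) g 0 j k + jmul f (shift ax1 g) 0 j k).
    eapply Rle_trans; [apply (step ax1 0%nat j k c c' phi psi)|].
    -- apply IHj; [apply (maj_shift ax1), Hf|exact Hg].
    -- apply IHj; [exact Hf|apply (maj_shift ax1), Hg].
    -- right. simpl. ring.
- change (jmul f g (S i) j k) with
    (jmul (shift axt f) g i j k + jmul f (shift axt g) i j k).
  eapply Rle_trans; [apply (step axt i j k c c' phi psi)|].
  -- apply IHi; [apply (maj_shift axt), Hf|exact Hg].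
  -- apply IHi; [exact Hf|apply (maj_shift axt), Hg].
  -- right. simpl. ring.
Qed.

(** * The analytic Cauchy problem *)

(** The denominator makes the series reproduce itself under multiplication up to a constant, so that
    nonlinear terms keep the same majorant. *)
Definition phi (r : R) (n : nat) : R := r ^ n / INR (S n) ^ 2.

Lemma phi_pos r n : 0 < r -> 0 < phi r n.
Proof.
intros Hr. apply Rdiv_lt_0_compat; [now apply pow_lt|].
apply pow_lt, lt_0_INR. lia.
Qed.

Lemma sum_f_R0_rev (f : nat -> R) n :
  sum_f_R0 (fun k => f (n - k)%nat) n = sum_f_R0 f n.
Proof.
revert f; induction n as [|n IH]; intros f; [reflexivity|].
rewrite decomp_sum by lia. simpl pred. rewrite tech5, <- (IH f).
replace (S n - 0)%nat with (S n) by lia. rewrite Rplus_comm. f_equal.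
Qed.

(** Telescoping: [1 / (x + 1)^2 <= 1 / x - 1 / (x + 1)]. *)
Lemma sum_inv_sqr_le n :
  sum_f_R0 (fun k => / INR (S k) ^ 2) n <= 2 - / INR (S n).
Proof.
induction n as [|n IH]; [simpl; lra|].
rewrite tech5. eapply Rle_trans; [apply Rplus_le_compat_r, IH|].
rewrite (S_INR (S n)). set (x := INR (S n)).
assert (Hx : 0 < x) by (apply lt_0_INR; lia).
assert (E : / x - / (x + 1) - / (x + 1) ^ 2 = / (x * (x + 1) ^ 2)).
{ field; lra. }
assert (0 < / (x * (x + 1) ^ 2)).
{ apply Rinv_0_lt_compat. apply Rmult_lt_0_compat; [lra|]. apply pow_lt; lra. }
lra.
Qed.

(** With [x = k + 1], [y = n - k + 1] and [z = n + 1 = x + y - 1], one has [z^2 <= 2 (x^2 + y^2)],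
    hence [1 / (x^2 y^2) <= 2 (1 / x^2 + 1 / y^2) / z^2]. Each of the two sums of inverse squares is
    at most 2, whence 8. *)
Lemma phi_mult r n : 0 < r -> PS_mult (phi r) (phi r) n <= 8 * phi r n.
Proof.
intros Hr. unfold PS_mult, phi.
set (g := fun k => / INR (S k) ^ 2).
assert (Hn : 0 < INR (S n)) by (apply lt_0_INR; lia).
assert (Hrn : 0 < r ^ n) by (now apply pow_lt).
eapply Rle_trans with
  (sum_f_R0 (fun k => (g k + g (n - k)%nat) * (2 * r ^ n / INR (S n) ^ 2)) n).
- apply sum_Rle. intros k Hk. unfold g.
  replace (r ^ n) with (r ^ k * r ^ (n - k))
    by (rewrite <- pow_add; f_equal; lia).
  set (x := INR (S k)). set (y := INR (S (n - k))).
  assert (Hx : 0 < x) by (apply lt_0_INR; lia).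
  assert (Hy : 0 < y) by (apply lt_0_INR; lia).
  assert (Hxy : INR (S n) = x + y - 1).
  { unfold x, y. rewrite !S_INR, minus_INR by lia. ring. }
  rewrite Hxy in *. set (z := x + y - 1) in *.
  set (c := r ^ k * r ^ (n - k)).
  assert (Hc : 0 < c) by (apply Rmult_lt_0_compat; now apply pow_lt).
  replace (r ^ k / x ^ 2 * (r ^ (n - k) / y ^ 2)) with (c * / (x ^ 2 * y ^ 2))
    by (unfold c; field; lra).
  replace ((/ x ^ 2 + / y ^ 2) * (2 * c / z ^ 2))
    with (c * (/ (x ^ 2 * y ^ 2) * (2 * (x ^ 2 + y ^ 2) / z ^ 2)))
    by (field; lra).
  apply Rmult_le_compat_l; [lra|].
  rewrite <- (Rmult_1_r (/ (x ^ 2 * y ^ 2))) at 1.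
  apply Rmult_le_compat_l.
  { apply Rlt_le, Rinv_0_lt_compat, Rmult_lt_0_compat; apply pow_lt; lra. }
  apply Rmult_le_reg_r with (z ^ 2); [apply pow_lt; lra|].
  unfold Rdiv. rewrite Rmult_assoc, Rinv_l, Rmult_1_l, Rmult_1_r
    by (apply pow_nonzero; lra).
  assert (0 <= (x - y) ^ 2) by apply pow2_ge_0.
  assert (z ^ 2 <= (x + y) ^ 2) by (apply pow_incr; unfold z in *; lra).
  lra.
- rewrite <- scal_sum, sum_plus, sum_f_R0_rev.
  assert (H := sum_inv_sqr_le n). fold g in H.
  assert (0 < / INR (S n)) by (now apply Rinv_0_lt_compat).
  replace (8 * (r ^ n / INR (S n) ^ 2)) with ((2 * r ^ n / INR (S n) ^ 2) * 4)
    by (field; lra).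
  apply Rmult_le_compat_l; [|lra].
  apply Rlt_le, Rdiv_lt_0_compat; [lra|]. apply pow_lt; lra.
Qed.

Lemma phi_0 r : phi r 0 = 1.
Proof. unfold phi. simpl. field. Qed.

#[local] Opaque phi.

(** The left side is one of the two nonnegative Leibniz terms of the derivative of the square of
    [phi r], to which [phi_mult] applies. *)
Lemma phi_mult_derive r n : 0 < r ->
  PS_mult (phi r) (PS_derive (phi r)) n <= 8 * PS_derive (phi r) n.
Proof.
intros Hr. unfold PS_derive at 2.
assert (H := PS_mult_derive (phi r) (phi r) n).
assert (H1 : 0 <= PS_mult (PS_derive (phi r)) (phi r) n).
{ apply cond_pos_sum. intros k. unfold PS_derive.
  assert (0 < INR (S k)) by (apply lt_0_INR; lia).
  apply Rlt_le; repeat apply Rmult_lt_0_compat; auto using phi_pos. }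
assert (H2 := phi_mult r (S n) Hr).
assert (0 < INR (S n)) by (apply lt_0_INR; lia). nra.
Qed.

Lemma maj_le c c' A K psi psi' f :
  0 <= A -> 0 <= K -> (forall n, c * psi n <= c' * psi' n) ->
  maj c A K psi f -> maj c' A K psi' f.
Proof.
intros HA HK Hp H i j k. eapply Rle_trans; [apply H|].
set (n := (i + j + k)%nat).
replace (c * A ^ (i + k) * K ^ j * (INR (fact n) * psi n))
  with ((A ^ (i + k) * K ^ j * INR (fact n)) * (c * psi n)) by ring.
replace (c' * A ^ (i + k) * K ^ j * (INR (fact n) * psi' n))
  with ((A ^ (i + k) * K ^ j * INR (fact n)) * (c' * psi' n)) by ring.
apply Rmult_le_compat_l; [|apply Hp].
repeat apply Rmult_le_pos; auto using pow_le, pos_INR.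
Qed.

Lemma maj_ge_1 c A K psi f :
  1 <= A -> 1 <= K -> (forall n, 0 <= c * psi n) ->
  maj c 1 1 psi f -> maj c A K psi f.
Proof.
intros HA HK Hp H i j k. eapply Rle_trans; [apply H|].
rewrite !pow1, !Rmult_1_r. set (n := (i + j + k)%nat).
replace (c * (INR (fact n) * psi n))
  with (1 * (INR (fact n) * (c * psi n))) by ring.
replace (c * A ^ (i + k) * K ^ j * (INR (fact n) * psi n))
  with ((A ^ (i + k) * K ^ j) * (INR (fact n) * (c * psi n))) by ring.
apply Rmult_le_compat_r; [apply Rmult_le_pos; auto using pos_INR|].
rewrite <- (Rmult_1_r 1).
apply Rmult_le_compat; try lra; apply pow_R1_Rle; lra.
Qed.

Lemma maj_jadd c c' A K psi f g :
  maj c A K psi f -> maj c' A K psi g -> maj (c + c') A K psi (jadd f g).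
Proof.
intros Hf Hg i j k. unfold jadd.
eapply Rle_trans; [apply Rabs_triang|].
specialize (Hf i j k). specialize (Hg i j k). lra.
Qed.

Lemma maj_jscal c d A K psi f :
  maj c A K psi f -> maj (Rabs d * c) A K psi (jscal d f).
Proof.
intros Hf i j k. unfold jscal. rewrite Rabs_mult.
specialize (Hf i j k).
replace (Rabs d * c * A ^ (i + k) * K ^ j *
   (INR (fact (i + j + k)) * psi (i + j + k)%nat))
  with (Rabs d * (c * A ^ (i + k) * K ^ j *
   (INR (fact (i + j + k)) * psi (i + j + k)%nat))) by ring.
apply Rmult_le_compat_l; [apply Rabs_pos|exact Hf].
Qed.

(** * Polynomial and first-order differential expressions in the unknowns *)

Definition dominated (psi : nat -> R) (f : jet) : Prop :=
  exists c, 0 <= c /\ maj c 1 1 psi f.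

Section CauchyProblem.

Variables (I : Type) (r : R).
Hypothesis (Hr : 0 < r).

Let state := I -> jet.

(** Polynomials in the unknowns with known coefficients. A predicate on functions of the state plays
    the role of a syntax: locality and majorants follow by induction on it. *)
Inductive op0 : (state -> jet) -> Prop :=
| op0_known f : dominated (phi r) f -> op0 (fun _ => f)
| op0_var m : op0 (fun Z => Z m)
| op0_add E F : op0 E -> op0 F -> op0 (fun Z => jadd (E Z) (F Z))
| op0_scal c E : op0 E -> op0 (fun Z => jscal c (E Z))
| op0_mul E F : op0 E -> op0 F -> op0 (fun Z => jmul (E Z) (F Z)).

(** Expressions that are affine in the first [ax2]-derivatives of the unknowns
    (if the flag is set; free of them otherwise). Known jets may be as large as
    a first derivative. *)
Inductive op1 : bool -> (state -> jet) -> Prop :=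
| op1_known b f : dominated (PS_derive (phi r)) f -> op1 b (fun _ => f)
| op1_deriv m : op1 true (fun Z => shift ax2 (Z m))
| op1_add b E F : op1 b E -> op1 b F -> op1 b (fun Z => jadd (E Z) (F Z))
| op1_scal b c E : op1 b E -> op1 b (fun Z => jscal c (E Z))
| op1_mul b E F : op0 E -> op1 b F -> op1 b (fun Z => jmul (E Z) (F Z)).

Definition agree (Z Z' : state) (i j k : nat) : Prop :=
  forall m a b c, (a <= i)%nat -> (b <= j)%nat -> (c <= k)%nat ->
    Z m a b c = Z' m a b c.

Lemma op0_local E Z Z' i j k :
  op0 E -> agree Z Z' i j k -> E Z i j k = E Z' i j k.
Proof.
intros HE; revert i j k; induction HE; intros i j k Hag.
- reflexivity.
- apply Hag; lia.
- unfold jadd. now rewrite IHHE1, IHHE2.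
- unfold jscal. now rewrite IHHE.
- apply jmul_local. intros a b c Ha Hb Hc.
  split; [apply IHHE1|apply IHHE2]; intros m a' b' c' ? ? ?; apply Hag; lia.
Qed.

Lemma op1_local b E Z Z' i j k :
  op1 b E -> agree Z Z' i j (if b then S k else k) -> E Z i j k = E Z' i j k.
Proof.
intros HE; revert i j k; induction HE; intros i j k Hag.
- reflexivity.
- apply Hag; lia.
- unfold jadd. now rewrite IHHE1, IHHE2.
- unfold jscal. now rewrite IHHE.
- apply jmul_local. intros x y z Hx Hy Hz.
  split; [apply (op0_local E); [assumption|]|apply IHHE];
    intros m a' b' c' ? ? ?; apply Hag; destruct b; lia.
Qed.

Lemma op0_bound E : op0 E -> forall B, 0 <= B -> exists C, 0 <= C /\
  forall A K Z, 1 <= A -> 1 <= K -> (forall m, maj B A K (phi r) (Z m)) ->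
    maj C A K (phi r) (E Z).
Proof.
intros HE B HB; induction HE.
- destruct H as [c [Hc H]]. exists c; split; [exact Hc|].
  intros A K Z HA HK _. apply maj_ge_1; auto.
  intros n. apply Rmult_le_pos; auto using Rlt_le, phi_pos.
- exists B; auto.
- destruct IHHE1 as [C1 [HC1 H1]], IHHE2 as [C2 [HC2 H2]].
  exists (C1 + C2); split; [lra|]. intros; apply maj_jadd; auto.
- destruct IHHE as [C1 [HC1 H1]].
  exists (Rabs c * C1); split; [apply Rmult_le_pos; auto using Rabs_pos|].
  intros; apply maj_jscal; auto.
- destruct IHHE1 as [C1 [HC1 H1]], IHHE2 as [C2 [HC2 H2]].
  exists (8 * (C1 * C2)); split; [nra|].
  intros. apply maj_le with (C1 * C2) (PS_mult (phi r) (phi r)); try lra.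
  + intros n. assert (Hphi := phi_mult r n Hr).
    assert (0 <= C1 * C2) by nra. nra.
  + apply maj_jmul; auto.
Qed.

(** The order of quantifiers is the point. An [ax2]-derivative costs a factor [A], so with the flag
    set [C] depends on the value [A0] of [A]; it never depends on [K], and without the flag one [C]
    serves every [A]. *)
Lemma op1_bound b E : op1 b E -> forall B A0, 0 <= B -> 1 <= A0 ->
  exists C, 0 <= C /\
  forall A K Z, 1 <= A -> 1 <= K -> (b = true -> A = A0) ->
    (forall m, maj B A K (phi r) (Z m)) ->
    maj C A K (PS_derive (phi r)) (E Z).
Proof.
intros HE B A0 HB HA0; induction HE.
- destruct H as [c [Hc H]]. exists c; split; [exact Hc|].
  intros A K Z HA HK _ _. apply maj_ge_1; auto.
  intros n. unfold PS_derive.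
  repeat apply Rmult_le_pos; auto using pos_INR, Rlt_le, phi_pos.
- exists (B * A0); split; [nra|]. intros A K Z HA HK Hb H.
  rewrite <- (Hb eq_refl). apply (maj_shift ax2), H.
- destruct IHHE1 as [C1 [HC1 H1]], IHHE2 as [C2 [HC2 H2]].
  exists (C1 + C2); split; [lra|]. intros; apply maj_jadd; auto.
- destruct IHHE as [C1 [HC1 H1]].
  exists (Rabs c * C1); split; [apply Rmult_le_pos; auto using Rabs_pos|].
  intros; apply maj_jscal; auto.
- destruct (op0_bound E H B HB) as [C1 [HC1 H1]], IHHE as [C2 [HC2 H2]].
  exists (8 * (C1 * C2)); split; [nra|].
  intros. apply maj_le with (C1 * C2) (PS_mult (phi r) (PS_derive (phi r)));
    try lra.
  + intros n. assert (Hphi := phi_mult_derive r n Hr).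
    assert (0 <= C1 * C2) by nra. nra.
  + apply maj_jmul; auto.
Qed.

(** * Recursive construction and majorant of the solution *)

Variables (l : list I) (F1 F2 Ft : I -> state -> jet) (z0 : I -> R).
Hypothesis (Hl : forall m, In m l).
Hypothesis (HF1 : forall m, op1 true (F1 m)).
Hypothesis (HF2 : forall m, op1 false (F2 m)).
Hypothesis (HFt : forall m, op1 false (Ft m)).

Lemma uniform_bound (P : I -> R -> Prop) :
  (forall m c c', c <= c' -> P m c -> P m c') -> (forall m, exists c, P m c) ->
  exists c, 1 <= c /\ forall m, P m c.
Proof.
intros Hmon H.
assert (G : exists c, 1 <= c /\ forall m, In m l -> P m c).
{ clear Hl. induction l as [|m l' IH].
  - exists 1; split; [lra|]. intros m [].
  - destruct IH as [c [Hc IH]], (H m) as [c' Hc'].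
    exists (Rmax c c'); split; [eapply Rle_trans; [exact Hc|apply Rmax_l]|].
    intros m' [<-|Hm'].
    + apply Hmon with c'; [apply Rmax_r|exact Hc'].
    + apply Hmon with c; [apply Rmax_l|auto]. }
destruct G as [c [Hc G]]. exists c; auto.
Qed.

(** The [ax1]-equation takes precedence, then [ax2], then [axt]. The Cauchy data on [x1 = a1] are
    thereby given by differential equations as well, with a single value [z0 m] left to
    prescribe. *)
Definition cauchy_step (Z : state) : state := fun m i j k =>
  match j, k, i with
  | S j', _, _ => F1 m Z i j' k
  | O, S k', _ => F2 m Z i O k'
  | O, O, S i' => Ft m Z i' O O
  | O, O, O => z0 m
  end.

(** [F1] reads the derivative [ax2], of the same total order as the derivative
    [ax1] it computes: weighting [ax1] twice makes the recursion well founded. *)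
Definition weight (i j k : nat) : nat := (i + 2 * j + k)%nat.

Lemma cauchy_step_local n Z Z' :
  (forall m i j k, (weight i j k < n)%nat -> Z m i j k = Z' m i j k) ->
  forall m i j k, (weight i j k < S n)%nat ->
    cauchy_step Z m i j k = cauchy_step Z' m i j k.
Proof.
unfold weight. intros H m i j k Hw. unfold cauchy_step.
destruct j as [|j']; [destruct k as [|k']; [destruct i as [|i']|]|].
- reflexivity.
- apply (op1_local false); [apply HFt|]. intros m' a b c ? ? ?; apply H; lia.
- apply (op1_local false); [apply HF2|]. intros m' a b c ? ? ?; apply H; lia.
- apply (op1_local true); [apply HF1|]. intros m' a b c ? ? ?; apply H; lia.
Qed.

Definition cauchy_iter (n : nat) : state :=
  Nat.iter n cauchy_step (fun _ _ _ _ => 0).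

Definition cauchy_sol : state :=
  fun m i j k => cauchy_iter (S (weight i j k)) m i j k.

Lemma cauchy_iter_stable n p m i j k :
  (weight i j k < n)%nat ->
  cauchy_iter (p + n) m i j k = cauchy_iter n m i j k.
Proof.
revert p m i j k. induction n as [|n IH]; intros p m i j k Hw; [lia|].
rewrite Nat.add_succ_r. simpl.
apply (cauchy_step_local n); [|exact Hw]. intros; now apply IH.
Qed.

Lemma cauchy_sol_step : cauchy_step cauchy_sol = cauchy_sol.
Proof.
apply functional_extensionality; intros m. apply jet_ext; intros i j k.
unfold cauchy_sol at 2. simpl.
apply (cauchy_step_local (weight i j k)); [|lia].
intros m' a b c Hw. unfold cauchy_sol.
replace (weight i j k) with
  ((weight i j k - S (weight a b c)) + S (weight a b c))%nat by lia.
symmetry. apply cauchy_iter_stable. lia.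
Qed.

Lemma cauchy_sol_bound : exists B A K, 0 <= B /\ 1 <= A /\ 1 <= K /\
  forall m, maj B A K (phi r) (cauchy_sol m).
Proof.
destruct (uniform_bound (fun m c => Rabs (z0 m) <= c)) as [B [HB0 HB]].
{ intros; lra. }
{ intros m; exists (Rabs (z0 m)); lra. }
assert (E : forall b (F : I -> state -> jet) A0, (forall m, op1 b (F m)) ->
  1 <= A0 -> exists C, 1 <= C /\ forall m A K Z,
    1 <= A -> 1 <= K -> (b = true -> A = A0) ->
    (forall m, maj B A K (phi r) (Z m)) ->
    maj C A K (PS_derive (phi r)) (F m Z)).
{ intros b F A0 HF HA0.
  destruct (uniform_bound (fun m C => forall A K Z,
    1 <= A -> 1 <= K -> (b = true -> A = A0) ->
    (forall m, maj B A K (phi r) (Z m)) ->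
    maj C A K (PS_derive (phi r)) (F m Z))) as [C [HC H]].
  - intros m c c' Hc H A K Z HA HK Hb HZ.
    apply maj_le with c (PS_derive (phi r)); try lra; [|auto].
    intros n. apply Rmult_le_compat_r; [|exact Hc]. unfold PS_derive.
    apply Rmult_le_pos; auto using pos_INR, Rlt_le, phi_pos.
  - intros m. destruct (op1_bound b (F m) (HF m) B A0) as [C [_ H]]; try lra.
    exists C; exact H.
  - exists C; split; auto. }
(* [C2] and [Ct] hold for every slope (the argument 1 is a placeholder), so [A] may be chosen above
   both. [C1] depends on this [A] only, and is itself taken as the slope [K]. *)
destruct (E false F2 1 HF2) as [C2 [HC2 H2]]; [lra|].
destruct (E false Ft 1 HFt) as [Ct [HCt Ht]]; [lra|].
destruct (E true F1 (Rmax C2 Ct) HF1) as [C1 [HC1 H1]].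
{ eapply Rle_trans; [exact HC2|apply Rmax_l]. }
set (A := Rmax C2 Ct) in *.
assert (HA2 : C2 <= A) by apply Rmax_l.
assert (HAt : Ct <= A) by apply Rmax_r.
exists B, A, C1. do 3 (split; [lra|]).
enough (G : forall n m i j k, (weight i j k < n)%nat ->
  Rabs (cauchy_sol m i j k) <= B * A ^ (i + k) * C1 ^ j *
    (INR (fact (i + j + k)) * phi r (i + j + k)%nat)).
{ intros m i j k. apply (G (S (weight i j k))). lia. }
induction n as [|n IH]; [lia|]. intros m i j k Hw.
(* The estimates ask for a majorant of a whole state. Coefficients that are not yet bounded are
   replaced by 0; [cauchy_step] does not read them here. *)
pose (Z := fun m a b c =>
  if Nat.ltb (weight a b c) n then cauchy_sol m a b c else 0).
assert (HZ : forall m, maj B A C1 (phi r) (Z m)).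
{ intros m' a b c. unfold Z. destruct (Nat.ltb_spec (weight a b c) n).
  - apply IH; lia.
  - rewrite Rabs_R0. repeat apply Rmult_le_pos;
      auto using Rlt_le, phi_pos, pos_INR; try apply pow_le; lra. }
rewrite <- cauchy_sol_step, (cauchy_step_local n _ Z); [|
  intros m' a b c Hc; unfold Z; destruct (Nat.ltb_spec (weight a b c) n);
  [reflexivity|lia] |exact Hw].
(* The derivative just computed brings one more factor [x], either [A] or [K]; it absorbs the
   constant [C] because [1 <= B]. *)
assert (P : forall C x w t, 0 <= t -> 0 <= w -> 1 <= C <= x ->
  C * w * t <= B * (x * w) * t).
{ intros C x w t Hxt Hxw Hx. apply Rmult_le_compat_r; [exact Hxt|].
  rewrite <- Rmult_assoc. apply Rmult_le_compat_r; [exact Hxw|]. nra. }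
assert (Q : forall n, 0 <= INR (fact n) * phi r n).
{ intros; apply Rmult_le_pos; auto using pos_INR, Rlt_le, phi_pos. }
unfold cauchy_step.
destruct j as [|j']; [destruct k as [|k']; [destruct i as [|i']|]|].
- simpl. rewrite !Rmult_1_r, Rmult_1_l. rewrite phi_0, Rmult_1_r. apply HB.
- eapply Rle_trans; [apply (Ht m A C1 Z); auto; try lra; discriminate|].
  rewrite <- fact_derive. simpl pow. rewrite !Rmult_1_r.
  replace (S i' + 0 + 0)%nat with (S (i' + 0 + 0)) by lia.
  replace (S i' + 0)%nat with (S (i' + 0)) by lia.
  apply P; auto; try lra; apply pow_le; lra.
- eapply Rle_trans; [apply (H2 m A C1 Z); auto; try lra; discriminate|].
  rewrite <- fact_derive. simpl pow. rewrite !Rmult_1_r.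
  replace (i + 0 + S k')%nat with (S (i + 0 + k')) by lia.
  replace (i + S k')%nat with (S (i + k')) by lia.
  apply P; auto; try lra; apply pow_le; lra.
- eapply Rle_trans; [apply (H1 m A C1 Z); auto; lra|].
  rewrite <- fact_derive.
  replace (i + S j' + k)%nat with (S (i + j' + k)) by lia.
  replace (B * A ^ (i + k) * C1 ^ S j')
    with (B * (C1 * (A ^ (i + k) * C1 ^ j'))) by (simpl; ring).
  rewrite (Rmult_assoc C1).
  apply P; auto; try lra; apply Rmult_le_pos; apply pow_le; lra.
Qed.

Theorem cauchy_problem_jets : exists Z : state,
  (exists B A K, 0 <= B /\ 1 <= A /\ 1 <= K /\
     forall m, maj B A K (phi r) (Z m)) /\
  (forall m, shift ax1 (Z m) = F1 m Z) /\
  (forall m i k, shift ax2 (Z m) i O k = F2 m Z i O k) /\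
  (forall m i, shift axt (Z m) i O O = Ft m Z i O O) /\
  forall m, Z m O O O = z0 m.
Proof.
exists cauchy_sol. split; [apply cauchy_sol_bound|].
assert (E : forall m i j k,
  cauchy_sol m i j k = cauchy_step cauchy_sol m i j k).
{ intros. now rewrite cauchy_sol_step. }
repeat split; intros.
- apply jet_ext; intros i j k. exact (E m i (S j) k).
- exact (E m i O (S k)).
- exact (E m (S i) O O).
Qed.

End CauchyProblem.

#[local] Transparent phi.

(** * Sums of power series *)

Definition vec (h k l : R) (e : axis) : R :=
  match e with axt => h | ax1 => k | ax2 => l end.

Definition upd (v : axis -> R) (e : axis) (s : R) (e' : axis) : R :=
  match e, e' with
  | axt, axt | ax1, ax1 | ax2, ax2 => s
  | _, _ => v e'
  end.

Definition norm1 (v : axis -> R) : R := Rabs (v axt) + Rabs (v ax1) + Rabs (v ax2).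

Definition dirD (v : axis -> R) (f : jet) : jet :=
  jadd (jscal (v axt) (shift axt f))
    (jadd (jscal (v ax1) (shift ax1 f)) (jscal (v ax2) (shift ax2 f))).

Definition dirDn (v : axis -> R) (n : nat) (f : jet) : jet :=
  Nat.iter n (dirD v) f.

(** The degree [n] part, at [v], of the power series with derivatives [f]. *)
Definition coef (v : axis -> R) (f : jet) (n : nat) : R :=
  dirDn v n f O O O / INR (fact n).

Definition ev (f : jet) (v : axis -> R) : R := Series (coef v f).

Lemma dirDn_S v n f : dirDn v (S n) f = dirDn v n (dirD v f).
Proof. apply Nat.iter_succ_r. Qed.

Lemma dirD_shift v e f : dirD v (shift e f) = shift e (dirD v f).
Proof. destruct e; reflexivity. Qed.

Lemma dirDn_shift v e n f : dirDn v n (shift e f) = shift e (dirDn v n f).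
Proof.
induction n as [|n IH]; [reflexivity|]. simpl. now rewrite IH, dirD_shift.
Qed.

Lemma dirDn_jadd v n f g : dirDn v n (jadd f g) = jadd (dirDn v n f) (dirDn v n g).
Proof.
induction n as [|n IH]; [reflexivity|]. simpl. rewrite IH.
apply jet_ext; intros; unfold dirD, jadd, jscal, shift; ring.
Qed.

Lemma dirDn_jscal v n c f : dirDn v n (jscal c f) = jscal c (dirDn v n f).
Proof.
induction n as [|n IH]; [reflexivity|]. simpl. rewrite IH.
apply jet_ext; intros; unfold dirD, jadd, jscal, shift; ring.
Qed.

Lemma dirD_jmul v f g :
  dirD v (jmul f g) = jadd (jmul (dirD v f) g) (jmul f (dirD v g)).
Proof.
unfold dirD. rewrite !shift_jmul, !jmul_addl, !jmul_addr, !jmul_scall, !jmul_scalr.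
apply jet_ext; intros; unfold jadd, jscal; ring.
Qed.

(** Euler's relation for homogeneous polynomials; it reduces identities between Taylor sums to the
    Leibniz rule for [dirD]. *)
Lemma coef_S v f n : INR (S n) * coef v f (S n) = coef v (dirD v f) n.
Proof.
unfold coef. rewrite dirDn_S, fact_simpl, mult_INR. field.
split; [apply INR_fact_neq_0|apply not_0_INR; lia].
Qed.

Lemma coef_jadd v f g n : coef v (jadd f g) n = coef v f n + coef v g n.
Proof. unfold coef. rewrite dirDn_jadd. unfold jadd. field. apply INR_fact_neq_0. Qed.

Lemma coef_jscal v c f n : coef v (jscal c f) n = c * coef v f n.
Proof. unfold coef. rewrite dirDn_jscal. unfold jscal. field. apply INR_fact_neq_0. Qed.

Lemma coef_jmul v f g n : coef v (jmul f g) n = PS_mult (coef v f) (coef v g) n.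
Proof.
revert f g; induction n as [|n IH]; intros f g.
- unfold PS_mult, coef. simpl. field.
- assert (HS : INR (S n) <> 0) by (apply not_0_INR; lia).
  apply Rmult_eq_reg_l with (INR (S n)); [|exact HS].
  assert (D : forall f, PS_derive (coef v f) = coef v (dirD v f)).
  { intros h. apply functional_extensionality; intros m. apply coef_S. }
  rewrite coef_S, dirD_jmul, coef_jadd, !IH, <- PS_mult_derive, !D. reflexivity.
Qed.

Lemma coef_jconst v c n : coef v (jconst c) n = match n with O => c | _ => 0 end.
Proof.
destruct n as [|n]; [unfold coef; simpl; field|].
unfold coef. rewrite dirDn_S.
replace (dirD v (jconst c)) with (jscal 0 (jconst 0)).
{ rewrite dirDn_jscal. unfold jscal. rewrite Rmult_0_l. unfold Rdiv. ring. }
unfold dirD. rewrite !shift_jconst. apply jet_ext; intros.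
unfold jadd, jscal. replace (jconst 0 i j k) with 0 by (destruct i, j, k; reflexivity).
ring.
Qed.

Lemma dirDn_bound phi f v n i j k : maj 1 1 1 phi f ->
  Rabs (dirDn v n f i j k)
    <= norm1 v ^ n * (INR (fact (n + i + j + k)) * phi (n + i + j + k)%nat).
Proof.
intros H; revert i j k; induction n as [|n IH]; intros i j k.
- simpl. eapply Rle_trans; [apply H|]. rewrite !pow1. lra.
- simpl dirDn. unfold dirD, jadd, jscal, shift.
  assert (H1 := IH (S i) j k). assert (H2 := IH i (S j) k).
  assert (H3 := IH i j (S k)).
  replace (n + S i + j + k)%nat with (S (n + i + j + k)) in H1 by lia.
  replace (n + i + S j + k)%nat with (S (n + i + j + k)) in H2 by lia.
  replace (n + i + j + S k)%nat with (S (n + i + j + k)) in H3 by lia.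
  change (S n + i + j + k)%nat with (S (n + i + j + k)).
  set (m := S (n + i + j + k)) in *. set (x := _ * (_ * phi m)) in H1, H2, H3.
  replace (norm1 v ^ S n * (INR (fact m) * phi m)) with (norm1 v * x)
    by (unfold x; simpl; ring).
  eapply Rle_trans; [apply Rabs_triang|].
  eapply Rle_trans; [apply Rplus_le_compat_l, Rabs_triang|].
  rewrite !Rabs_mult. unfold norm1.
  assert (P : forall a b, Rabs b <= x -> Rabs a * Rabs b <= Rabs a * x).
  { intros a b. apply Rmult_le_compat_l, Rabs_pos. }
  assert (P1 := P (v axt) _ H1). assert (P2 := P (v ax1) _ H2).
  assert (P3 := P (v ax2) _ H3). lra.
Qed.

Lemma coef_bound phi f v n : maj 1 1 1 phi f ->
  Rabs (coef v f n) <= phi n * norm1 v ^ n.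
Proof.
intros H. unfold coef, Rdiv.
assert (Hf : 0 < INR (fact n)) by apply INR_fact_lt_0.
rewrite Rabs_mult, (Rabs_right (/ _))
  by (apply Rle_ge, Rlt_le, Rinv_0_lt_compat; exact Hf).
apply Rmult_le_reg_r with (INR (fact n)); [exact Hf|].
rewrite Rmult_assoc, Rinv_l, Rmult_1_r by lra.
eapply Rle_trans; [apply dirDn_bound, H|]. right. rewrite !Nat.add_0_r. ring.
Qed.

Lemma maj_nonneg phi f n : maj 1 1 1 phi f -> 0 <= phi n.
Proof.
intros H. specialize (H n O O). rewrite !pow1, !Nat.add_0_r in H.
assert (H1 := Rle_trans _ _ _ (Rabs_pos _) H).
assert (0 < INR (fact n)) by apply INR_fact_lt_0. nra.
Qed.

(** [conv r f]: the power series with derivatives [f] at the origin is dominated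
    by a function of [t + x1 + x2] analytic in the disc of radius [r]. *)
Definition conv (r : R) (f : jet) : Prop :=
  exists phi, maj 1 1 1 phi f /\ Rbar_le r (CV_radius phi).

Lemma CV_radius_ge (a : nat -> R) r :
  (forall x, 0 <= x < r -> exists M, forall n, Rabs (a n * x ^ n) <= M) ->
  Rbar_le r (CV_radius a).
Proof.
intros H. destruct (CV_radius_bounded a) as [Hub _].
assert (H0 := CV_radius_ge_0 a).
destruct (Rbar_le_lt_dec r (CV_radius a)) as [|Hlt]; [assumption|exfalso].
destruct (CV_radius a) as [c| |]; simpl in *; try easy.
assert (Hc : Rbar_le ((c + r) / 2) c).
{ apply Hub. apply H. lra. }
simpl in Hc. lra.
Qed.

Lemma maj_one c phi psi f :
  maj c 1 1 phi f -> (forall n, c * phi n <= psi n) -> maj 1 1 1 psi f.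
Proof.
intros H Hle. apply maj_le with c phi; try lra; [|exact H].
intros n. specialize (Hle n). lra.
Qed.

Lemma conv_shift r e f : conv r f -> conv r (shift e f).
Proof.
intros [phi [H Hr]]. exists (PS_derive phi). split.
- apply (maj_shift e) in H. replace (1 * _) with 1 in H by (destruct e; ring).
  exact H.
- now rewrite CV_radius_derive.
Qed.

Lemma conv_jadd r f g : conv r f -> conv r g -> conv r (jadd f g).
Proof.
intros [phi [H Hr]] [psi [H' Hr']]. exists (PS_plus phi psi). split.
- intros i j k. eapply Rle_trans; [apply Rabs_triang|].
  eapply Rle_trans; [apply Rplus_le_compat; [apply H|apply H']|].
  right. unfold PS_plus, plus; simpl. ring.
- eapply Rbar_le_trans; [|apply CV_radius_plus].
  apply Rbar_min_case; assumption.
Qed.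

Lemma conv_jscal r c f : conv r f -> conv r (jscal c f).
Proof.
intros [phi [H Hr]]. exists (PS_scal (Rabs c + 1) phi). split.
(* The majorant carries [Rabs c + 1] in place of [Rabs c], since scaling preserves the radius of
   convergence only for a nonzero factor. *)
- apply maj_one with (Rabs c * 1) phi; [now apply maj_jscal|].
  intros n. assert (Hn := maj_nonneg _ _ n H).
  unfold PS_scal, scal; simpl; unfold mult; simpl. nra.
- rewrite CV_radius_scal; [exact Hr|]. assert (Hc := Rabs_pos c). lra.
Qed.

Lemma conv_jmul r f g : conv r f -> conv r g -> conv r (jmul f g).
Proof.
intros [phi [H Hr]] [psi [H' Hr']]. exists (PS_mult phi psi). split.
- rewrite <- (Rmult_1_r 1) at 1. now apply maj_jmul.
- apply CV_radius_ge. intros x Hx.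
  assert (E : ex_series (fun n => PS_mult phi psi n * x ^ n)).
  { destruct (ex_pseries_mult phi psi x) as [l Hl].
    - eapply Rbar_lt_le_trans; [|exact Hr]. simpl. rewrite Rabs_pos_eq; lra.
    - eapply Rbar_lt_le_trans; [|exact Hr']. simpl. rewrite Rabs_pos_eq; lra.
    - exists l. exact (proj1 (is_pseries_R (PS_mult phi psi) x l) Hl). }
  apply ex_series_lim_0, is_lim_seq_Reals in E.
  destruct (maj_by_pos _ (exist _ 0 E)) as [M [_ HM]]. exists M; exact HM.
Qed.

Lemma conv_jconst r c : conv r (jconst c).
Proof.
exists (fun n => match n with O => Rabs c | _ => 0 end). split.
- intros i j k. destruct i, j, k; simpl; rewrite ?Rabs_R0, ?pow1; lra.
- rewrite <- CV_radius_decr_1.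
  rewrite (CV_radius_ext _ (fun _ => 0)) by reflexivity.
  rewrite CV_radius_const_0. exact I.
Qed.

Lemma ex_series_abs_coef r f v :
  conv r f -> norm1 v < r -> ex_series (fun n => Rabs (coef v f n)).
Proof.
intros [phi [H Hr]] Hv.
apply (ex_series_le (K := R_AbsRing) (V := R_CompleteNormedModule)) with
  (fun n => Rabs (phi n * norm1 v ^ n)).
- intros n. unfold norm; simpl. unfold abs; simpl. rewrite Rabs_Rabsolu.
  eapply Rle_trans; [apply coef_bound, H|apply Rle_abs].
- apply CV_disk_inside. eapply Rbar_lt_le_trans; [|exact Hr].
  simpl. rewrite Rabs_pos_eq; [exact Hv|].
  unfold norm1. assert (P := fun e => Rabs_pos (v e)).
  assert (P1 := P axt). assert (P2 := P ax1). assert (P3 := P ax2). lra.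
Qed.

Lemma ex_series_coef r f v :
  conv r f -> norm1 v < r -> ex_series (coef v f).
Proof. intros H Hv. eapply ex_series_Rabs, ex_series_abs_coef; eassumption. Qed.

Lemma ev_jadd r f g v : conv r f -> conv r g -> norm1 v < r ->
  ev (jadd f g) v = ev f v + ev g v.
Proof.
intros Hf Hg Hv. unfold ev.
rewrite <- Series_plus by (eapply ex_series_coef; eassumption).
apply Series_ext. intros. apply coef_jadd.
Qed.

Lemma ev_jscal c f v : ev (jscal c f) v = c * ev f v.
Proof.
unfold ev. rewrite <- Series_scal_l. apply Series_ext. intros. apply coef_jscal.
Qed.

Lemma ev_jmul r f g v : conv r f -> conv r g -> norm1 v < r ->
  ev (jmul f g) v = ev f v * ev g v.
Proof.
intros Hf Hg Hv. unfold ev. apply is_series_unique.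
apply is_series_ext with (PS_mult (coef v f) (coef v g)).
{ intros; symmetry; apply coef_jmul. }
apply is_series_mult; try (eapply ex_series_abs_coef; eassumption);
  apply Series_correct; eapply ex_series_coef; eassumption.
Qed.

Lemma ev_jconst c v : ev (jconst c) v = c.
Proof.
unfold ev. apply is_series_unique.
apply is_series_ext with (fun n => match n with O => c | _ => 0 end).
{ intros; symmetry; apply coef_jconst. }
apply is_series_Reals. intros eps Heps. exists O. intros n _.
replace (sum_f_R0 _ n) with c; [now rewrite R_dist_eq|].
induction n as [|n IH]; [reflexivity|]. simpl. rewrite <- IH. ring.
Qed.

Lemma ev_bound r f r1 : conv r f -> r1 < r ->
  exists C, 0 <= C /\ forall v, norm1 v <= r1 -> Rabs (ev f v) <= C.
Proof.
intros [phi [H Hr]] Hr1.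
destruct (Rle_lt_dec 0 r1) as [H0|H0].
2:{ exists 0. split; [lra|]. intros v Hv. exfalso.
  unfold norm1 in Hv. assert (P := fun e => Rabs_pos (v e)).
  assert (P1 := P axt). assert (P2 := P ax1). assert (P3 := P ax2). lra. }
assert (E : ex_series (fun n => phi n * r1 ^ n)).
{ apply ex_series_Rabs, CV_disk_inside. eapply Rbar_lt_le_trans; [|exact Hr].
  simpl. rewrite Rabs_pos_eq; lra. }
assert (Hb : forall v n, norm1 v <= r1 -> Rabs (coef v f n) <= phi n * r1 ^ n).
{ intros v n Hv. eapply Rle_trans; [apply coef_bound, H|].
  apply Rmult_le_compat_l; [eapply maj_nonneg, H|]. apply pow_incr.
  split; [|exact Hv]. unfold norm1. assert (P := fun e => Rabs_pos (v e)).
  assert (P1 := P axt). assert (P2 := P ax1). assert (P3 := P ax2). lra. }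
exists (Series (fun n => phi n * r1 ^ n)). split.
- replace 0 with (Series (fun _ : nat => 0 * 0)) by (rewrite Series_scal_l; ring).
  apply Series_le; [|exact E]. intros n. rewrite Rmult_0_l. split; [lra|].
  apply Rmult_le_pos; [eapply maj_nonneg, H|apply pow_le, H0].
- intros v Hv. unfold ev.
  eapply Rle_trans; [apply Series_Rabs|].
  + apply (ex_series_le (K := R_AbsRing) (V := R_CompleteNormedModule)) with
      (fun n => phi n * r1 ^ n); [|exact E].
    intros n. unfold norm; simpl. unfold abs; simpl. rewrite Rabs_Rabsolu.
    now apply Hb.
  + apply Series_le; [|exact E]. intros n. split; [apply Rabs_pos|now apply Hb].
Qed.

(** * Differentiation and continuity of the sums *)

(** The mean value theorem, used twice, bounds the first-order Taylor remainder of the [n]-th term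
    by [b n * y^2]. Summing gives a quadratic remainder for the series. *)
Lemma is_derive_Series (a a' a'' : nat -> R -> R) (b : nat -> R) s0 eps :
  0 < eps ->
  (forall n s, Rabs (s - s0) <= eps -> is_derive (a n) s (a' n s)) ->
  (forall n s, Rabs (s - s0) <= eps -> is_derive (a' n) s (a'' n s)) ->
  (forall n s, Rabs (s - s0) <= eps -> Rabs (a'' n s) <= b n) -> ex_series b ->
  (forall s, Rabs (s - s0) <= eps -> ex_series (fun n => a n s)) ->
  ex_series (fun n => a' n s0) ->
  is_derive (fun s => Series (fun n => a n s)) s0 (Series (fun n => a' n s0)).
Proof.
intros Heps Ha Ha' Hb Eb Ea Ea'.
assert (MVT : forall f f' y, (forall s, Rabs (s - s0) <= eps -> is_derive f s (f' s)) ->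
  Rabs y <= eps -> exists c, Rabs (c - s0) <= Rabs y /\ f (s0 + y) - f s0 = f' c * y).
{ intros f f' y Hf Hy.
  assert (Hin : forall c, Rmin s0 (s0 + y) <= c <= Rmax s0 (s0 + y) ->
    Rabs (c - s0) <= Rabs y).
  { intros c Hc. unfold Rmin, Rmax in Hc.
    destruct (Rle_dec s0 (s0 + y)); unfold Rabs;
      destruct (Rcase_abs (c - s0)), (Rcase_abs y); lra. }
  destruct (MVT_gen f s0 (s0 + y) f') as [c [Hc E]].
  - intros x Hx. apply Hf. eapply Rle_trans; [apply Hin; lra|exact Hy].
  - intros x Hx. apply continuity_pt_filterlim, (ex_derive_continuous f).
    exists (f' x). apply Hf. eapply Rle_trans; [apply Hin; lra|exact Hy].
  - exists c. split; [now apply Hin|]. rewrite E. ring. }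
assert (Taylor : forall n y, Rabs y <= eps ->
  Rabs (a n (s0 + y) - a n s0 - y * a' n s0) <= b n * (y * y)).
{ intros n y Hy. destruct (MVT (a n) (a' n) y) as [c [Hc E]]; auto.
  destruct (MVT (a' n) (a'' n) (c - s0)) as [d [Hd E']]; [auto|lra|].
  replace (s0 + (c - s0)) with c in E' by ring.
  rewrite E. replace (a' n c * y - y * a' n s0) with (y * (a' n c - a' n s0)) by ring.
  rewrite E'. rewrite !Rabs_mult.
  replace (y * y) with (Rabs y * Rabs y) by (rewrite <- Rabs_mult; apply Rabs_pos_eq; nra).
  assert (Hbd : Rabs (a'' n d) <= b n) by (apply Hb; lra).
  assert (P := Rabs_pos y). assert (P1 := Rabs_pos (a'' n d)).
  assert (P2 := Rabs_pos (c - s0)).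
  replace (b n * (Rabs y * Rabs y)) with (Rabs y * (b n * Rabs y)) by ring.
  apply Rmult_le_compat_l; [exact P|].
  apply Rmult_le_compat; assumption. }
set (B := Series b).
assert (HB : 0 <= B).
{ unfold B. replace 0 with (Series (fun _ : nat => 0 * 0)) by (rewrite Series_scal_l; ring).
  apply Series_le; [|exact Eb]. intros n. rewrite Rmult_0_l. split; [lra|].
  eapply Rle_trans; [apply Rabs_pos|apply (Hb n s0)].
  rewrite Rminus_diag, Rabs_R0. lra. }
assert (E0 : ex_series (fun n => a n s0)).
{ apply Ea. rewrite Rminus_diag, Rabs_R0. lra. }
assert (Main : forall y, Rabs y <= eps ->
  Rabs (Series (fun n => a n (s0 + y)) - Series (fun n => a n s0)
    - y * Series (fun n => a' n s0)) <= B * (y * y)).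
{ intros y Hy.
  assert (Ey : ex_series (fun n => a n (s0 + y))).
  { apply Ea. now replace (s0 + y - s0) with y by ring. }
  rewrite <- Series_scal_l, <- Series_minus, <- Series_minus; auto.
  2:{ now apply (ex_series_minus (V := R_NormedModule)). }
  2:{ exact (ex_series_scal_l (V := R_NormedModule) y _ Ea'). }
  assert (Eb' : ex_series (fun n => b n * (y * y))) by (now apply ex_series_scal_r).
  eapply Rle_trans; [apply Series_Rabs|].
  - apply (ex_series_le (K := R_AbsRing) (V := R_CompleteNormedModule)) with
      (fun n => b n * (y * y)); [|exact Eb'].
    intros n. unfold norm; simpl. unfold abs; simpl. rewrite Rabs_Rabsolu.
    now apply Taylor.
  - unfold B. rewrite <- Series_scal_r. apply Series_le; [|exact Eb'].
    intros n. split; [apply Rabs_pos|now apply Taylor]. }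
apply is_derive_Reals. intros e He.
(* [B] may be 0, hence the divisor [B + 1]. *)
assert (Hd : 0 < Rmin eps (e / (B + 1))).
{ apply Rmin_glb_lt; [exact Heps|]. apply Rdiv_lt_0_compat; lra. }
exists (mkposreal _ Hd). intros y Hy0 Hy. simpl in Hy.
assert (Hy1 : Rabs y < eps) by (eapply Rlt_le_trans; [exact Hy|apply Rmin_l]).
assert (Hy2 : Rabs y < e / (B + 1)) by (eapply Rlt_le_trans; [exact Hy|apply Rmin_r]).
assert (HM := Main y (Rlt_le _ _ Hy1)).
set (l := Series (fun n => a' n s0)) in *.
set (D := _ - Series (fun n => a n s0)) in HM |- *.
replace (D / y - l) with ((D - y * l) / y) by (field; exact Hy0).
unfold Rdiv. rewrite Rabs_mult, Rabs_inv.
assert (P : 0 < Rabs y) by (now apply Rabs_pos_lt).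
apply Rmult_lt_reg_r with (Rabs y); [exact P|].
rewrite Rmult_assoc, Rinv_l, Rmult_1_r by lra.
eapply Rle_lt_trans; [exact HM|].
replace (y * y) with (Rabs y * Rabs y) by (rewrite <- Rabs_mult; apply Rabs_pos_eq; nra).
rewrite <- Rmult_assoc. apply Rmult_lt_compat_r; [exact P|].
apply Rle_lt_trans with ((B + 1) * Rabs y); [nra|].
apply Rlt_le_trans with ((B + 1) * (e / (B + 1))); [apply Rmult_lt_compat_l; lra|].
right. field. lra.
Qed.

Lemma upd_id v e : upd v e (v e) = v.
Proof. apply functional_extensionality; intros []; destruct e; reflexivity. Qed.

Lemma upd_same v e s : upd v e s e = s.
Proof. destruct e; reflexivity. Qed.

Lemma upd_upd v e s s' : upd (upd v e s) e s' = upd v e s'.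
Proof. apply functional_extensionality; intros []; destruct e; reflexivity. Qed.

Lemma norm1_upd v e s : norm1 (upd v e s) <= norm1 v + Rabs (s - v e).
Proof.
assert (H := Rabs_triang (v e) (s - v e)).
replace (v e + (s - v e)) with s in H by ring.
unfold norm1; destruct e; simpl; lra.
Qed.

Lemma norm1_pos v : 0 <= norm1 v.
Proof.
unfold norm1. assert (P := fun e => Rabs_pos (v e)).
assert (P1 := P axt). assert (P2 := P ax1). assert (P3 := P ax2). lra.
Qed.

Definition dcoef (v : axis -> R) (e : axis) (f : jet) (n : nat) : R :=
  match n with O => 0 | S m => coef v (shift e f) m end.

Lemma is_derive_eq (f : R -> R) (x l l' : R) :
  is_derive f x l -> l = l' -> is_derive f x l'.
Proof. intros H <-. exact H. Qed.

Lemma is_derive_constR (c x : R) : is_derive (fun _ : R => c) x 0.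
Proof. exact (is_derive_const (V := R_NormedModule) c x). Qed.

Lemma is_derive_idR (x : R) : is_derive (fun s : R => s) x 1.
Proof. exact (is_derive_id x). Qed.

(** The varying coordinate enters each of the [n] equal factors [dirD], and these commute with
    [shift e]. *)
Lemma is_derive_dirDn v e n f i j k s :
  is_derive (fun s => dirDn (upd v e s) n f i j k) s
    (INR n * dirDn (upd v e s) (pred n) (shift e f) i j k).
Proof.
revert i j k. induction n as [|n IH]; intros i j k.
- simpl. rewrite Rmult_0_l. apply is_derive_constR.
- set (g := dirDn (upd v e s) (pred n) (shift e f)) in *.
  apply is_derive_ext with (fun s =>
    upd v e s axt * dirDn (upd v e s) n f (S i) j k
    + (upd v e s ax1 * dirDn (upd v e s) n f i (S j) k
       + upd v e s ax2 * dirDn (upd v e s) n f i j (S k))).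
  { reflexivity. }
  assert (D : forall e', is_derive (fun s => upd v e s e') s
    (match e, e' with axt, axt | ax1, ax1 | ax2, ax2 => 1 | _, _ => 0 end)).
  { intros e'. destruct e, e'; simpl; try apply is_derive_constR; apply is_derive_idR. }
  assert (M : forall e' i j k, is_derive
    (fun s => upd v e s e' * dirDn (upd v e s) n f i j k) s
    (match e, e' with axt, axt | ax1, ax1 | ax2, ax2 => 1 | _, _ => 0 end
       * dirDn (upd v e s) n f i j k + upd v e s e' * (INR n * g i j k))).
  { intros e' i' j' k'.
    apply (is_derive_mult (fun s => upd v e s e')
      (fun s => dirDn (upd v e s) n f i' j' k')); auto. intros; apply Rmult_comm. }
  eapply is_derive_eq; [apply (@is_derive_plus R_AbsRing R_NormedModule);
    [apply M|apply (@is_derive_plus R_AbsRing R_NormedModule); apply M]|].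
  unfold plus; simpl.
  assert (G : INR n * dirD (upd v e s) g i j k
    = INR n * dirDn (upd v e s) n (shift e f) i j k).
  { destruct n as [|n]; [simpl; ring|]. reflexivity. }
  rewrite (dirDn_shift (upd v e s) e n f) in G.
  change (dirDn (upd v e s) (pred (S n)) (shift e f))
    with (dirDn (upd v e s) n (shift e f)).
  rewrite dirDn_shift.
  change (INR (S n)) with (match n with O => 1 | S _ => INR n + 1 end).
  replace (match n with O => 1 | S _ => INR n + 1 end) with (INR n + 1)
    by (destruct n; simpl; ring).
  rewrite Rmult_plus_distr_r, Rmult_1_l, <- G.
  unfold dirD, jadd, jscal, shift. destruct e; ring.
Qed.

Lemma is_derive_coef v e f n s :
  is_derive (fun s => coef (upd v e s) f n) s (dcoef (upd v e s) e f n).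
Proof.
unfold coef, Rdiv.
apply is_derive_ext with
  (fun s => / INR (fact n) * dirDn (upd v e s) n f O O O).
{ intros. apply Rmult_comm. }
eapply is_derive_eq; [apply is_derive_scal, is_derive_dirDn|].
destruct n as [|n]; unfold dcoef; [simpl; ring|].
unfold coef. simpl pred. rewrite fact_simpl, mult_INR. field.
split; [apply INR_fact_neq_0|apply not_0_INR; lia].
Qed.

Lemma ex_series_dcoef r f v e :
  conv r f -> norm1 v < r -> ex_series (dcoef v e f).
Proof.
intros H Hv. apply ex_series_incr_1. apply (ex_series_coef r); [|exact Hv].
now apply conv_shift.
Qed.

Lemma Series_dcoef r f v e :
  conv r f -> norm1 v < r -> Series (dcoef v e f) = ev (shift e f) v.
Proof.
intros H Hv. rewrite Series_incr_1 by (eapply ex_series_dcoef; eassumption).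
apply Rplus_0_l.
Qed.

Lemma is_derive_ev r f v e :
  conv r f -> norm1 v < r ->
  is_derive (fun s => ev f (upd v e s)) (v e) (ev (shift e f) v).
Proof.
intros H Hv.
replace (ev (shift e f) v) with (Series (dcoef (upd v e (v e)) e f))
  by (rewrite upd_id; now apply (Series_dcoef r)).
(* The majorant of the doubly shifted jet bounds the second derivatives of the terms. Those of
   degree 0 and 1 vanish, which explains the offset by two in the bounding sequence below. *)
destruct (conv_shift _ e _ (conv_shift _ e _ H)) as [phi [Hphi Hr]].
set (eps := (r - norm1 v) / 2).
set (r1 := norm1 v + eps).
assert (Hr1 : r1 < r) by (unfold r1, eps; lra).
assert (Hn : forall s, Rabs (s - v e) <= eps -> norm1 (upd v e s) <= r1).
{ intros s Hs. assert (Hu := norm1_upd v e s). unfold r1. lra. }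
apply (is_derive_Series
  (fun n s => coef (upd v e s) f n)
  (fun n s => dcoef (upd v e s) e f n)
  (fun n s => match n with
     | O => 0 | S n' => dcoef (upd v e s) e (shift e f) n' end)
  (fun n => match n with
     | S (S n') => Rabs (phi n' * r1 ^ n') | _ => 0 end) (v e) eps).
- unfold eps. lra.
- intros n s _. apply is_derive_coef.
- intros n s _. destruct n as [|n]; simpl; [apply is_derive_constR|].
  apply is_derive_coef.
- intros n s Hs. destruct n as [|[|n]]; simpl; rewrite ?Rabs_R0; try lra.
  eapply Rle_trans; [apply coef_bound, Hphi|].
  eapply Rle_trans; [|apply Rle_abs].
  apply Rmult_le_compat_l; [eapply maj_nonneg, Hphi|].
  apply pow_incr. split; [apply norm1_pos|now apply Hn].
- apply ex_series_incr_1, ex_series_incr_1. apply CV_disk_inside.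
  eapply Rbar_lt_le_trans; [|exact Hr].
  simpl. rewrite Rabs_pos_eq; [exact Hr1|].
  assert (P := norm1_pos v). unfold r1, eps. lra.
- intros s Hs. apply (ex_series_coef r); [exact H|].
  specialize (Hn s Hs). lra.
- rewrite upd_id. now apply (ex_series_dcoef r).
Qed.

(** Joint continuity is obtained by changing one coordinate at a time; the hypothesis on the norm
    keeps the connecting segment inside the region where the derivatives are bounded. *)
Lemma ev_lipschitz r f r1 : conv r f -> r1 < r ->
  exists C, 0 <= C /\ forall v e s,
    norm1 v + Rabs (s - v e) <= r1 ->
    Rabs (ev f (upd v e s) - ev f v) <= C * Rabs (s - v e).
Proof.
intros H Hr1.
assert (G : exists C, 0 <= C /\ forall v e, norm1 v <= r1 -> Rabs (ev (shift e f) v) <= C).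
{ destruct (ev_bound r (shift axt f) r1) as [Ct [Pt Ht]]; auto using conv_shift.
  destruct (ev_bound r (shift ax1 f) r1) as [C1 [P1 H1]]; auto using conv_shift.
  destruct (ev_bound r (shift ax2 f) r1) as [C2 [P2 H2]]; auto using conv_shift.
  exists (Ct + C1 + C2). split; [lra|]. intros v e Hv.
  specialize (Ht v Hv). specialize (H1 v Hv). specialize (H2 v Hv).
  destruct e; lra. }
destruct G as [C [HC G]]. exists C. split; [exact HC|]. intros v e s Hs.
assert (Hin : forall c, Rmin (v e) s <= c <= Rmax (v e) s ->
  Rabs (c - v e) <= Rabs (s - v e)).
{ intros c Hc. unfold Rmin, Rmax in Hc.
  destruct (Rle_dec (v e) s); unfold Rabs;
    destruct (Rcase_abs (c - v e)), (Rcase_abs (s - v e)); lra. }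
assert (Hu : forall c, Rmin (v e) s <= c <= Rmax (v e) s ->
  norm1 (upd v e c) <= r1).
{ intros c Hc. eapply Rle_trans; [apply norm1_upd|]. specialize (Hin c Hc). lra. }
assert (D : forall c, Rmin (v e) s <= c <= Rmax (v e) s ->
  is_derive (fun s => ev f (upd v e s)) c (ev (shift e f) (upd v e c))).
{ intros c Hc. rewrite <- (upd_same v e c) at 1.
  apply is_derive_ext with (fun s => ev f (upd (upd v e c) e s)).
  { intros t. now rewrite upd_upd. }
  apply (is_derive_ev r); [exact H|]. specialize (Hu c Hc). lra. }
destruct (MVT_gen (fun s => ev f (upd v e s)) (v e) s
  (fun c => ev (shift e f) (upd v e c))) as [c [Hc E]].
- intros x Hx. apply D. lra.
- intros x Hx. apply continuity_pt_filterlim, (ex_derive_continuous (V := R_NormedModule)).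
  eexists. apply D, Hx.
- rewrite upd_id in E. rewrite E, Rabs_mult.
  apply Rmult_le_compat_r; [apply Rabs_pos|]. apply G, Hu, Hc.
Qed.

(** The field with Taylor expansion [f] at [(0, a1, a2)]. *)
Definition jfield (a1 a2 : R) (f : jet) : field :=
  fun t x1 x2 => ev f (vec t (x1 - a1) (x2 - a2)).

Definition dist1 (a1 a2 t x1 x2 : R) : R := norm1 (vec t (x1 - a1) (x2 - a2)).

Lemma jfield_continuous r a1 a2 f t x1 x2 :
  conv r f -> dist1 a1 a2 t x1 x2 < r ->
  continuous (fun q : R * R * R =>
    jfield a1 a2 f (fst (fst q)) (snd (fst q)) (snd q)) (t, x1, x2).
Proof.
intros H Hv. unfold dist1 in Hv. set (n0 := norm1 _) in Hv.
set (r1 := (n0 + r) / 2).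
destruct (ev_lipschitz r f r1 H) as [C [HC L]]; [unfold r1; lra|].
apply filterlim_locally. intros eps.
(* Three moves shorter than [d1] stay within a quarter of the gap [r - n0], below [r1]; three moves
   shorter than [d2] change the value by less than [eps]. *)
set (d1 := (r - n0) / 12). set (d2 := eps / (3 * (C + 1))).
assert (Hd1 : 0 < d1) by (unfold d1; lra).
assert (Hd2 : 0 < d2).
{ apply Rdiv_lt_0_compat; [apply cond_pos|lra]. }
exists (mkposreal _ (Rmin_glb_lt _ _ _ Hd1 Hd2)).
intros [[t' y1] y2] [[Ht H1] H2]. simpl in *.
unfold ball in Ht, H1, H2. simpl in Ht, H1, H2.
unfold AbsRing_ball, abs, minus, plus, opp in Ht, H1, H2. simpl in Ht, H1, H2.
change (Rabs (t' + - t) < Rmin d1 d2) in Ht.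
change (Rabs (y1 + - x1) < Rmin d1 d2) in H1.
change (Rabs (y2 + - x2) < Rmin d1 d2) in H2.
assert (M1 := Rmin_l d1 d2). assert (M2 := Rmin_r d1 d2).
change (Rabs (jfield a1 a2 f t' y1 y2 - jfield a1 a2 f t x1 x2) < eps).
unfold jfield.
set (v0 := vec t (x1 - a1) (x2 - a2)).
set (v1 := upd v0 axt t'). set (v2 := upd v1 ax1 (y1 - a1)).
replace (vec t' (y1 - a1) (y2 - a2)) with (upd v2 ax2 (y2 - a2))
  by (apply functional_extensionality; intros []; reflexivity).
assert (N1 : norm1 v1 <= n0 + Rabs (t' + - t)) by apply norm1_upd.
assert (N2 : norm1 v2 <= norm1 v1 + Rabs (y1 - a1 - (x1 - a1))) by apply norm1_upd.
assert (L0 := L v0 axt t'). assert (L1 := L v1 ax1 (y1 - a1)).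
assert (L2 := L v2 ax2 (y2 - a2)). simpl in L0, L1, L2.
fold n0 in L0. fold v1 v2 in L0, L1, L2.
change (v1 ax1) with (x1 - a1) in L1. change (v2 ax2) with (x2 - a2) in L2.
replace (y1 - a1 - (x1 - a1)) with (y1 + - x1) in * by ring.
replace (y2 - a2 - (x2 - a2)) with (y2 + - x2) in * by ring.
replace (t' - t) with (t' + - t) in * by ring.
change (norm1 v0) with n0 in L0.
assert (E1 : 12 * d1 = r - n0) by (unfold d1; field).
assert (E2 : 2 * r1 = n0 + r) by (unfold r1; field).
specialize (L0 ltac:(lra)). specialize (L1 ltac:(lra)). specialize (L2 ltac:(lra)).
replace (ev f (upd v2 ax2 (y2 - a2)) - ev f v0)
  with ((ev f (upd v2 ax2 (y2 - a2)) - ev f v2) + (ev f v2 - ev f v1)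
        + (ev f v1 - ev f v0)) by ring.
eapply Rle_lt_trans; [apply Rabs_triang|].
eapply Rle_lt_trans; [apply Rplus_le_compat_r, Rabs_triang|].
assert (K : forall x, 0 <= x -> x < Rmin d1 d2 -> C * x <= C * d2).
{ intros x Hx Hx'. apply Rmult_le_compat_l; lra. }
assert (Kt := K _ (Rabs_pos _) Ht). assert (K1 := K _ (Rabs_pos _) H1).
assert (K2 := K _ (Rabs_pos _) H2).
assert (E : 3 * (C * d2) + 3 * d2 = eps) by (unfold d2; field; lra).
lra.
Qed.

Definition axis_of (i : idx) : axis := match i with i1 => ax1 | i2 => ax2 end.

(** A relation, so that existence of the derivative is part of the claim, unlike with [pd]. *)
Definition is_pd (e : axis) (F : field) (t x1 x2 l : R) : Prop :=
  match e with
  | axt => is_derive (fun s => F s x1 x2) t l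
  | ax1 => is_derive (fun s => F t s x2) x1 l
  | ax2 => is_derive (fun s => F t x1 s) x2 l
  end.

Lemma jfield_is_pd r a1 a2 f e t x1 x2 :
  conv r f -> dist1 a1 a2 t x1 x2 < r ->
  is_pd e (jfield a1 a2 f) t x1 x2 (jfield a1 a2 (shift e f) t x1 x2).
Proof.
intros H Hv. assert (D := is_derive_ev r f _ e H Hv).
assert (T : forall (F : R -> R) x a l,
  is_derive F (x - a) l -> is_derive (fun s => F (s - a)) x l).
{ intros F x a l HF. eapply eq_rect.
  - apply (is_derive_comp F (fun s => s - a)); [exact HF|].
    apply (@is_derive_minus R_AbsRing R_NormedModule);
      [apply is_derive_idR|apply is_derive_constR].
  - unfold scal, minus, plus, opp, one, zero; simpl; unfold mult; simpl. ring. }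
unfold jfield. destruct e; simpl in D |- *.
- eapply is_derive_ext; [|exact D]. intros s. simpl. f_equal.
  apply functional_extensionality; intros []; reflexivity.
- eapply is_derive_ext; [|apply T, D]. intros s. simpl. f_equal.
  apply functional_extensionality; intros []; reflexivity.
- eapply is_derive_ext; [|apply T, D]. intros s. simpl. f_equal.
  apply functional_extensionality; intros []; reflexivity.
Qed.

(** An open region contains a segment of each coordinate line through each of
    its points. *)
Lemma open_is_pd_ext (V : region) e F G t x1 x2 l :
  open V -> V (t, x1, x2) ->
  (forall t x1 x2, V (t, x1, x2) -> F t x1 x2 = G t x1 x2) ->
  is_pd e F t x1 x2 l -> is_pd e G t x1 x2 l.
Proof.
intros HV Hq HFG. destruct (HV _ Hq) as [eps He].
destruct e; apply is_derive_ext_loc; exists eps; intros s Hs;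
  apply HFG, He; repeat split; simpl; auto; apply ball_center.
Qed.

Definition pdx (e : axis) (F : field) : field :=
  match e with axt => pd_t F | ax1 => pd i1 F | ax2 => pd i2 F end.

Lemma is_pd_unique e F t x1 x2 l : is_pd e F t x1 x2 l -> pdx e F t x1 x2 = l.
Proof. destruct e; apply is_derive_unique. Qed.

(** Stated for any [F] that agrees with a jet field on [V], because the induction passes to the
    partial derivatives of [F], which are known on [V] only. *)
Lemma jfield_Cn_on r a1 a2 (V : region) : open V ->
  (forall t x1 x2, V (t, x1, x2) -> dist1 a1 a2 t x1 x2 < r) ->
  forall n f F, conv r f ->
  (forall t x1 x2, V (t, x1, x2) -> F t x1 x2 = jfield a1 a2 f t x1 x2) ->
  Cn_on n V F.
Proof.
intros HV Hr n. induction n as [|n IH]; intros f F Hf HF.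
all: assert (D : forall e t x1 x2, V (t, x1, x2) ->
  is_pd e F t x1 x2 (jfield a1 a2 (shift e f) t x1 x2))
  by (intros e t x1 x2 Hq; apply (open_is_pd_ext V e (jfield a1 a2 f)); auto;
      [intros; symmetry; auto|apply (jfield_is_pd r); auto]).
all: assert (Cont : forall t x1 x2, V (t, x1, x2) ->
  continuous (fun q : R * R * R => F (fst (fst q)) (snd (fst q)) (snd q)) (t, x1, x2))
  by (intros t x1 x2 Hq;
      apply (continuous_ext_loc _ (fun q : R * R * R =>
        jfield a1 a2 f (fst (fst q)) (snd (fst q)) (snd q)));
      [destruct (HV _ Hq) as [eps He]; exists eps; intros [[t' y1] y2] Hy;
       simpl; symmetry; apply HF, He, Hy
      |apply (jfield_continuous r); auto]).
- split; [exact Cont|exact I].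
- split; [exact Cont|]. split; [|repeat split].
  + intros t x1 x2 Hq. repeat split; eexists;
      [apply (D axt)|apply (D ax1)|apply (D ax2)]; exact Hq.
  + apply (IH (shift axt f)); [now apply conv_shift|].
    intros t x1 x2 Hq. apply (is_pd_unique axt), D, Hq.
  + apply (IH (shift ax1 f)); [now apply conv_shift|].
    intros t x1 x2 Hq. apply (is_pd_unique ax1), D, Hq.
  + apply (IH (shift ax2 f)); [now apply conv_shift|].
    intros t x1 x2 Hq. apply (is_pd_unique ax2), D, Hq.
Qed.

(** * Analytic functions of three variables and their jets *)

Lemma sum_degree_R n F : sum_degree n F
  = sum_f_R0 (fun i => sum_f_R0 (fun j => F i j (n - i - j)%nat) (n - i)) n.
Proof.
unfold sum_degree. rewrite sum_n_Reals. apply sum_eq. intros i _.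
apply sum_n_Reals.
Qed.

Lemma sum_degree_ext n F G :
  (forall i j m, (i + j + m = n)%nat -> F i j m = G i j m) ->
  sum_degree n F = sum_degree n G.
Proof.
intros H. rewrite !sum_degree_R. apply sum_eq. intros i Hi.
apply sum_eq. intros j Hj. apply H. lia.
Qed.

Lemma sum_degree_plus n F G :
  sum_degree n (fun i j m => F i j m + G i j m) = sum_degree n F + sum_degree n G.
Proof.
rewrite !sum_degree_R, <- sum_plus. apply sum_eq. intros. apply sum_plus.
Qed.

Lemma sum_degree_scal n c F :
  sum_degree n (fun i j m => c * F i j m) = c * sum_degree n F.
Proof.
rewrite !sum_degree_R, scal_sum. apply sum_eq. intros.
rewrite Rmult_comm, scal_sum. apply sum_eq. intros. ring.
Qed.

Lemma sum_degree_shift_1 n F :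
  sum_degree (S n) (fun i j m => INR i * F i j m)
  = sum_degree n (fun i j m => INR (S i) * F (S i) j m).
Proof.
rewrite !sum_degree_R, (decomp_sum _ (S n)) by lia. simpl pred.
rewrite (sum_eq_R0 (fun j => INR 0 * _)), Rplus_0_l
  by (intros; simpl; ring).
apply sum_eq. intros. reflexivity.
Qed.

Lemma sum_degree_shift_2 n F :
  sum_degree (S n) (fun i j m => INR j * F i j m)
  = sum_degree n (fun i j m => INR (S j) * F i (S j) m).
Proof.
rewrite !sum_degree_R, tech5.
replace (S n - S n)%nat with O by lia. simpl (sum_f_R0 _ 0).
rewrite Rmult_0_l, Rplus_0_r.
apply sum_eq. intros i Hi. replace (S n - i)%nat with (S (n - i)) by lia.
rewrite decomp_sum by lia. simpl pred. simpl (INR 0).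
rewrite Rmult_0_l, Rplus_0_l.
apply sum_eq. intros. reflexivity.
Qed.

Lemma sum_degree_shift_3 n F :
  sum_degree (S n) (fun i j m => INR m * F i j m)
  = sum_degree n (fun i j m => INR (S m) * F i j (S m)).
Proof.
rewrite !sum_degree_R, tech5.
replace (S n - S n)%nat with O by lia. simpl (sum_f_R0 _ 0).
rewrite Rmult_0_l, Rplus_0_r.
apply sum_eq. intros i Hi. replace (S n - i)%nat with (S (n - i)) by lia.
rewrite tech5. replace (S (n - i) - S (n - i))%nat with O by lia.
simpl (INR 0). rewrite Rmult_0_l, Rplus_0_r.
apply sum_eq. intros j Hj.
now replace (S (n - i) - j)%nat with (S (n - i - j)) by lia.
Qed.

Definition monomial (v : axis -> R) (f : jet) (i j m : nat) : R :=
  f i j m / (INR (fact i) * INR (fact j) * INR (fact m))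
  * v axt ^ i * v ax1 ^ j * v ax2 ^ m.

(** Both sides satisfy Euler's relation: on the right the factor [n + 1 = i + j + m] splits into
    three sums, each of which is an index shift along one axis. *)
Lemma coef_sum_degree v f n : coef v f n = sum_degree n (monomial v f).
Proof.
assert (F0 := INR_fact_neq_0).
assert (FS : forall n, INR (fact (S n)) = INR (S n) * INR (fact n)).
{ intros m. now rewrite fact_simpl, mult_INR. }
assert (NS : forall n, INR (S n) <> 0) by (intros; apply not_0_INR; lia).
revert f; induction n as [|n IH]; intros f.
- rewrite sum_degree_R. unfold coef, monomial. simpl. field.
- apply Rmult_eq_reg_l with (INR (S n)); [|apply NS].
  rewrite coef_S, IH, <- sum_degree_scal.
  rewrite (sum_degree_ext (S n) _ (fun i j m =>
    INR i * monomial v f i j m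
    + (INR j * monomial v f i j m + INR m * monomial v f i j m))).
  2:{ intros i j m <-. rewrite !plus_INR. ring. }
  rewrite !sum_degree_plus, sum_degree_shift_1, sum_degree_shift_2,
    sum_degree_shift_3, <- !sum_degree_plus.
  apply sum_degree_ext. intros i j m _.
  unfold monomial, dirD, jadd, jscal, shift. rewrite !FS. simpl pow.
  field. repeat split; auto.
Qed.

Lemma sum_degree_ge n F i j m :
  (forall i j m, 0 <= F i j m) -> (i + j + m = n)%nat -> F i j m <= sum_degree n F.
Proof.
intros HF Hn. rewrite sum_degree_R.
assert (T : forall (g : nat -> R) N k, (forall l, 0 <= g l) -> (k <= N)%nat ->
  g k <= sum_f_R0 g N).
{ intros g N k Hg. induction N as [|N IH]; intros Hk.
  - replace k with O by lia. simpl. lra.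
  - rewrite tech5. destruct (Nat.eq_dec k (S N)) as [->|Hne].
    + assert (H := cond_pos_sum g N Hg). lra.
    + specialize (IH ltac:(lia)). specialize (Hg (S N)). lra. }
eapply Rle_trans; [|apply (T (fun i => sum_f_R0 _ (n - i)) n i)].
- cbv beta. eapply Rle_trans; [|apply (T _ (n - i)%nat j)].
  + cbv beta. right. f_equal. lia.
  + intros; apply HF.
  + lia.
- intros; apply cond_pos_sum; intros; apply HF.
- lia.
Qed.

Lemma fact_mult_le i j : INR (fact i) * INR (fact j) <= INR (fact (i + j)).
Proof.
rewrite <- mult_INR. apply le_INR. induction i as [|i IH]; [simpl; lia|].
rewrite fact_simpl. replace (S i + j)%nat with (S (i + j)) by lia.
rewrite fact_simpl. nia.
Qed.

Lemma analytic_at_jet f t0 a1 a2 : analytic_at f t0 a1 a2 ->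
  exists (g : jet) (r C M : R), 0 < r /\ 0 <= C /\ 0 < M /\
    (forall i j k, Rabs (g i j k) <= C * (INR (fact (i + j + k)) * M ^ (i + j + k))) /\
    forall t x1 x2, Rabs (t - t0) < r -> Rabs (x1 - a1) < r -> Rabs (x2 - a2) < r ->
      f t x1 x2 = jfield a1 a2 g (t - t0) x1 x2.
Proof.
intros [c [r [Hr H]]].
set (g := fun i j k => c i j k * (INR (fact i) * INR (fact j) * INR (fact k))).
assert (F0 := INR_fact_neq_0). assert (Fp := INR_fact_lt_0).
assert (Hh : Rabs (r / 2) < r) by (rewrite Rabs_pos_eq; lra).
(* Convergence at this one point bounds the terms by some [C], hence each coefficient of degree [n]
   by [C * (2 / r)^n]. This replaces Cauchy's estimates. *)
destruct (H (r / 2) (r / 2) (r / 2) Hh Hh Hh) as [E _].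
apply ex_series_lim_0, is_lim_seq_Reals in E.
destruct (maj_by_pos _ (exist _ 0 E)) as [C [HC HCn]].
exists g, r, C, (2 / r).
split; [exact Hr|]. split; [lra|]. split; [apply Rdiv_lt_0_compat; lra|]. split.
- intros i j k. set (n := (i + j + k)%nat).
  assert (Hc : Rabs (c i j k) * (r / 2) ^ n <= C).
  { eapply Rle_trans; [|apply (HCn n)]. eapply Rle_trans; [|apply Rle_abs].
    eapply Rle_trans; [|apply (sum_degree_ge n _ i j k);
      [intros; apply Rabs_pos|reflexivity]].
    cbv beta. unfold n. rewrite !pow_add, !Rabs_mult, !(Rabs_pos_eq ((r / 2) ^ _))
      by (apply pow_le; lra). right; ring. }
  unfold g. rewrite Rabs_mult, (Rabs_pos_eq (_ * _ * _))
    by (apply Rlt_le; repeat apply Rmult_lt_0_compat; auto).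
  assert (Hf : INR (fact i) * INR (fact j) * INR (fact k) <= INR (fact n)).
  { eapply Rle_trans; [apply Rmult_le_compat_r; [apply Rlt_le, Fp|]|].
    - apply fact_mult_le.
    - apply fact_mult_le. }
  assert (Hp : 0 < (2 / r) ^ n) by (apply pow_lt, Rdiv_lt_0_compat; lra).
  assert (E1 : (r / 2) ^ n * (2 / r) ^ n = 1).
  { rewrite <- Rpow_mult_distr. replace (r / 2 * (2 / r)) with 1 by (field; lra).
    apply pow1. }
  assert (Hc' : Rabs (c i j k) <= C * (2 / r) ^ n).
  { replace (Rabs (c i j k)) with (Rabs (c i j k) * (r / 2) ^ n * (2 / r) ^ n)
      by (rewrite Rmult_assoc, E1; ring).
    apply Rmult_le_compat_r; lra. }
  replace (C * (INR (fact n) * (2 / r) ^ n)) with (C * (2 / r) ^ n * INR (fact n))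
    by ring.
  apply Rmult_le_compat; auto using Rabs_pos.
  apply Rlt_le; repeat apply Rmult_lt_0_compat; auto.
- intros t x1 x2 Ht H1 H2. destruct (H _ _ _ Ht H1 H2) as [_ Hs].
  replace (t0 + (t - t0)) with t in Hs by ring.
  replace (a1 + (x1 - a1)) with x1 in Hs by ring.
  replace (a2 + (x2 - a2)) with x2 in Hs by ring.
  apply is_series_unique in Hs. rewrite <- Hs. unfold jfield, ev.
  apply Series_ext. intros n. rewrite coef_sum_degree.
  apply sum_degree_ext. intros i j m _. unfold monomial, g. simpl vec.
  field. auto.
Qed.

Lemma sqr_S_le_pow n : INR (S n) ^ 2 <= 4 ^ n.
Proof.
replace 4 with (2 ^ 2) by ring. rewrite <- pow_mult, Nat.mul_comm, pow_mult.
apply pow_incr. split; [apply pos_INR|].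
induction n as [|n IH]; [simpl; lra|].
rewrite S_INR. simpl pow. assert (1 <= 2 ^ n) by (apply pow_R1_Rle; lra). lra.
Qed.

(** The factor 4 pays for the denominator of [phi], as [(n + 1)^2 <= 4^n]. *)
Lemma dominated_phi C M r (g : jet) : 0 <= C -> 0 <= M -> 4 * M <= r ->
  (forall i j k, Rabs (g i j k) <= C * (INR (fact (i + j + k)) * M ^ (i + j + k))) ->
  dominated (phi r) g.
Proof.
intros HC HM Hr H. exists C. split; [exact HC|]. intros i j k.
eapply Rle_trans; [apply H|]. rewrite !pow1, !Rmult_1_r.
apply Rmult_le_compat_l; [exact HC|]. apply Rmult_le_compat_l; [apply pos_INR|].
set (n := (i + j + k)%nat). unfold phi.
assert (Hn : 0 < INR (S n) ^ 2) by (apply pow_lt, lt_0_INR; lia).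
apply Rmult_le_reg_r with (INR (S n) ^ 2); [exact Hn|].
unfold Rdiv. rewrite Rmult_assoc, Rinv_l, Rmult_1_r by lra.
eapply Rle_trans; [apply Rmult_le_compat_l; [now apply pow_le|apply sqr_S_le_pow]|].
rewrite <- Rpow_mult_distr. apply pow_incr. split; [|lra]. lra.
Qed.

Lemma dominated_shift psi e g :
  dominated psi g -> dominated (PS_derive psi) (shift e g).
Proof.
intros [c [Hc H]]. exists c. split; [exact Hc|]. apply (maj_shift e) in H.
replace (c * _) with c in H by (destruct e; ring). exact H.
Qed.

Lemma dominated_jconst r c : 0 < r -> dominated (phi r) (jconst c).
Proof.
intros Hr. apply dominated_phi with (Rabs c) 0; try lra; [apply Rabs_pos|].
intros i j k. destruct i, j, k; simpl; rewrite ?Rabs_R0; try lra.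
all: try (rewrite !Rmult_0_l, !Rmult_0_r; lra).
Qed.

Lemma dominated_derive_jconst r c : 0 < r -> dominated (PS_derive (phi r)) (jconst c).
Proof.
(* The derivative of the series [phi r] has constant term [phi r 1 = r / 4]. *)
intros Hr. exists (Rabs c * (4 / r)).
assert (Hd : 0 < 4 / r) by (apply Rdiv_lt_0_compat; lra).
assert (Hc := Rabs_pos c). split; [nra|]. intros i j k.
assert (P : forall n, 0 <= PS_derive (phi r) n).
{ intros n. apply Rmult_le_pos; [apply pos_INR|apply Rlt_le, phi_pos, Hr]. }
rewrite !pow1, !Rmult_1_r.
destruct i, j, k; simpl jconst; rewrite ?Rabs_R0;
  try (apply Rmult_le_pos; [nra|apply Rmult_le_pos; auto using pos_INR]).
simpl. unfold PS_derive, phi. simpl. right. field. lra.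
Qed.

Lemma conv_of_maj c A K r r0 f : 0 <= c -> 1 <= A -> 1 <= K -> 0 < r ->
  r0 * (r * (A * K)) <= 1 -> maj c A K (phi r) f -> conv r0 f.
Proof.
intros Hc HA HK Hr Hr0 H. set (b := r * (A * K)) in *.
assert (Hb : 0 < b) by (unfold b; repeat apply Rmult_lt_0_compat; lra).
exists (fun n => c * b ^ n). split.
- intros i j k. eapply Rle_trans; [apply H|]. rewrite !pow1, !Rmult_1_l.
  set (n := (i + j + k)%nat).
  replace (c * A ^ (i + k) * K ^ j * (INR (fact n) * phi r n))
    with (c * INR (fact n) * (A ^ (i + k) * K ^ j * phi r n)) by ring.
  replace (INR (fact n) * (c * b ^ n)) with (c * INR (fact n) * b ^ n) by ring.
  apply Rmult_le_compat_l; [apply Rmult_le_pos; [exact Hc|apply pos_INR]|].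
  unfold b. rewrite !Rpow_mult_distr.
  assert (H1 : A ^ (i + k) <= A ^ n) by (apply Rle_pow; [exact HA|unfold n; lia]).
  assert (H2 : K ^ j <= K ^ n) by (apply Rle_pow; [exact HK|unfold n; lia]).
  assert (H3 : phi r n <= r ^ n).
  { unfold phi. assert (Hn : 1 <= INR (S n) ^ 2).
    { apply pow_R1_Rle. change 1 with (INR 1). apply le_INR. lia. }
    apply Rmult_le_reg_r with (INR (S n) ^ 2); [lra|].
    unfold Rdiv. rewrite Rmult_assoc, Rinv_l, Rmult_1_r by lra.
    assert (0 < r ^ n) by (now apply pow_lt). nra. }
  rewrite (Rmult_comm (r ^ n)).
  apply Rmult_le_compat; [| |apply Rmult_le_compat|]; auto using pow_le, Rlt_le, phi_pos.
  + apply Rmult_le_pos; apply pow_le; lra.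
  + apply pow_le; lra.
  + apply pow_le; lra.
- apply CV_radius_ge. intros x Hx. exists c. intros n.
  rewrite Rmult_assoc, <- Rpow_mult_distr, Rabs_mult, Rabs_pos_eq by exact Hc.
  rewrite <- (Rmult_1_r c) at 2. apply Rmult_le_compat_l; [exact Hc|].
  rewrite Rabs_pos_eq by (apply pow_le; nra).
  rewrite <- (pow1 n). apply pow_incr. nra.
Qed.

(** * Surfaces in space *)

Section PartialDerivatives.

Variables (e : axis) (F G : field) (t x1 x2 lF lG : R).
Hypothesis (HF : is_pd e F t x1 x2 lF).

Lemma is_pd_plus : is_pd e G t x1 x2 lG ->
  is_pd e (fun t x1 x2 => F t x1 x2 + G t x1 x2) t x1 x2 (lF + lG).
Proof.
intros HG; destruct e; now apply (@is_derive_plus R_AbsRing R_NormedModule).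
Qed.

Lemma is_pd_mult : is_pd e G t x1 x2 lG -> is_pd e (fun t x1 x2 => F t x1 x2 * G t x1 x2) t x1 x2
  (lF * G t x1 x2 + F t x1 x2 * lG).
Proof.
intros HG; destruct e.
- exact (is_derive_mult (fun s => F s x1 x2) (fun s => G s x1 x2) t _ _ HF HG Rmult_comm).
- exact (is_derive_mult (fun s => F t s x2) (fun s => G t s x2) x1 _ _ HF HG Rmult_comm).
- exact (is_derive_mult (fun s => F t x1 s) (fun s => G t x1 s) x2 _ _ HF HG Rmult_comm).
Qed.

Lemma is_pd_opp : is_pd e (fun t x1 x2 => - F t x1 x2) t x1 x2 (- lF).
Proof.
destruct e; now apply (@is_derive_opp R_AbsRing R_NormedModule).
Qed.

Lemma is_pd_inv : F t x1 x2 <> 0 ->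
  is_pd e (fun t x1 x2 => / F t x1 x2) t x1 x2 (- lF / F t x1 x2 ^ 2).
Proof.
intros H; destruct e.
- now apply (is_derive_inv (fun s => F s x1 x2)).
- now apply (is_derive_inv (fun s => F t s x2)).
- now apply (is_derive_inv (fun s => F t x1 s)).
Qed.

Lemma is_pd_ln : 0 < F t x1 x2 ->
  is_pd e (fun t x1 x2 => ln (F t x1 x2)) t x1 x2 (lF / F t x1 x2).
Proof.
assert (D : forall (f : R -> R) x l, 0 < f x -> is_derive f x l ->
  is_derive (fun s => ln (f s)) x (l / f x)).
{ intros f x l Hx Hf. apply (is_derive_comp ln f x (/ f x) l); [|exact Hf].
  now apply is_derive_ln. }
intros H; destruct e.
- now apply (D (fun s => F s x1 x2)).
- now apply (D (fun s => F t s x2)).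
- now apply (D (fun s => F t x1 s)).
Qed.

Lemma is_pd_eq l : is_pd e F t x1 x2 l -> l = lF.
Proof.
intros H. now rewrite <- (is_pd_unique _ _ _ _ _ _ H), <- (is_pd_unique _ _ _ _ _ _ HF).
Qed.

End PartialDerivatives.

Lemma is_pd_const e c t x1 x2 : is_pd e (fun _ _ _ => c) t x1 x2 0.
Proof.
destruct e;
  [exact (is_derive_constR c t)|exact (is_derive_constR c x1)|exact (is_derive_constR c x2)].
Qed.

Definition ex_pd (e : axis) (F : field) (t x1 x2 : R) : Prop :=
  exists l, is_pd e F t x1 x2 l.

Lemma ex_pd_correct i F t x1 x2 :
  ex_pd (axis_of i) F t x1 x2 -> is_pd (axis_of i) F t x1 x2 (pd i F t x1 x2).
Proof.
intros [l H]. assert (E := is_pd_unique _ _ _ _ _ _ H).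
replace (pd i F t x1 x2) with l; [exact H|]. rewrite <- E. destruct i; reflexivity.
Qed.

Lemma is_pd_pd i F t x1 x2 l :
  is_pd (axis_of i) F t x1 x2 l -> pd i F t x1 x2 = l.
Proof. destruct i; apply is_derive_unique. Qed.

(** * Fields determined by prescribed derivatives *)

Definition box (a1 a2 eps t x1 x2 : R) : Prop :=
  Rabs t < eps /\ Rabs (x1 - a1) < eps /\ Rabs (x2 - a2) < eps.

Lemma dist1_box a1 a2 eps r t x1 x2 :
  3 * eps <= r -> box a1 a2 eps t x1 x2 -> dist1 a1 a2 t x1 x2 < r.
Proof. unfold box, dist1, norm1. simpl. lra. Qed.

Lemma derive_zero_constant (f : R -> R) c eps x :
  (forall s, Rabs (s - c) < eps -> is_derive f s 0) -> Rabs (x - c) < eps ->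
  f x = f c.
Proof.
intros H Hx.
assert (Hin : forall s, Rmin c x <= s <= Rmax c x -> Rabs (s - c) < eps).
{ intros s Hs. eapply Rle_lt_trans; [|exact Hx]. unfold Rmin, Rmax in Hs.
  destruct (Rle_dec c x); unfold Rabs;
    destruct (Rcase_abs (s - c)), (Rcase_abs (x - c)); lra. }
destruct (MVT_gen f c x (fun _ => 0)) as [d [_ E]].
- intros s Hs. apply H, Hin. lra.
- intros s Hs. apply continuity_pt_filterlim, (ex_derive_continuous (V := R_NormedModule)).
  exists 0. apply H, Hin, Hs.
- lra.
Qed.

(** The part of space-time on which the [e]-derivative of a solution of the
    Cauchy problem is prescribed. *)
Definition prescribed (a1 a2 : R) (e : axis) (x1 x2 : R) : Prop :=
  match e with ax1 => True | ax2 => x1 = a1 | axt => x1 = a1 /\ x2 = a2 end.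

(** Move [x1] to [a1], then [x2] to [a2], then [t] to 0: each leg lies where its derivative is
    prescribed. The algebraic relations between the adjoined unknowns are proved in this way. *)
Lemma prescribed_constant a1 a2 eps (F : field) : 0 < eps ->
  (forall e t x1 x2, box a1 a2 eps t x1 x2 -> prescribed a1 a2 e x1 x2 ->
     is_pd e F t x1 x2 0) ->
  forall t x1 x2, box a1 a2 eps t x1 x2 -> F t x1 x2 = F 0 a1 a2.
Proof.
intros Heps H t x1 x2 [Ht [H1 H2]].
assert (Z : forall a, Rabs (a - a) < eps) by (intros; rewrite Rminus_diag, Rabs_R0; lra).
rewrite (derive_zero_constant (fun s => F t s x2) a1 eps x1); [| |exact H1].
2:{ intros s Hs. apply (H ax1); [|exact I]. now repeat split. }
rewrite (derive_zero_constant (fun s => F t a1 s) a2 eps x2); [| |exact H2].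
2:{ intros s Hs. apply (H ax2); [|reflexivity]. now repeat split. }
apply (derive_zero_constant (fun s => F s a1 a2) 0 eps t).
- intros s Hs. rewrite Rminus_0_r in Hs. apply (H axt); now repeat split.
- now rewrite Rminus_0_r.
Qed.

#[local] Opaque is_pd.

(** * Vector algebra in space *)

Inductive coord := co1 | co2 | co3.

Definition dot (a b : coord -> R) : R := a co1 * b co1 + a co2 * b co2 + a co3 * b co3.

Definition cross (a b : coord -> R) (c : coord) : R :=
  match c with
  | co1 => a co2 * b co3 - a co3 * b co2
  | co2 => a co3 * b co1 - a co1 * b co3
  | co3 => a co1 * b co2 - a co2 * b co1
  end.

Lemma dot_cross_self a b :
  dot (cross a b) (cross a b) = dot a a * dot b b - dot a b * dot a b.
Proof. unfold dot, cross. ring. Qed.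

(** Expansion in the basis [a, b, a x b] by inverting the Gram matrix, multiplied through by its
    determinant. *)
Lemma frame_expansion a b w c :
  dot (cross a b) (cross a b) * w c
  = (dot b b * dot w a - dot a b * dot w b) * a c
    + (dot a a * dot w b - dot a b * dot w a) * b c
    + dot w (cross a b) * cross a b c.
Proof. unfold dot, cross. destruct c; ring. Qed.

(** The integrability condition obtained by equating [d_k y_ij] and [d_j y_ik],
    where [y_ij = sum_m G m i j y_m + h i j (y_1 x y_2)], is tested against the
    normal (Codazzi) and against [y_1] (Gauss). *)
Section Integrability.

Variables (y : idx -> coord -> R) (yy : idx -> idx -> coord -> R).
Variables (G : idx -> idx -> idx -> R) (h : idx -> idx -> R).
Let m := cross (y i1) (y i2).
Let dm l c := cross (yy i1 l) (y i2) c + cross (y i1) (yy i2 l) c.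
Hypothesis (HG : forall k, G k i2 i1 = G k i1 i2).
Hypothesis (Hh : h i2 i1 = h i1 i2).
Hypothesis (Hyy : forall i j c,
  yy i j c = G i1 i j * y i1 c + G i2 i j * y i2 c + h i j * m c).

Let D (i j l : idx) (dG : idx -> R) (dh : R) (c : coord) : R :=
  dG i1 * y i1 c + G i1 i j * yy i1 l c
  + (dG i2 * y i2 c + G i2 i j * yy i2 l c) + (dh * m c + h i j * dm l c).

(** The trace [G i1 i1 l + G i2 i2 l] is the logarithmic derivative of the length of the normal [m],
    which is not normalised; it gives Codazzi the form suited to coefficients divided by
    [sqrt (det g)]. *)
Lemma dot_D_normal i j l dG dh : dot (D i j l dG dh) m =
  dot m m * (dh + G i1 i j * h i1 l + G i2 i j * h i2 l
             + h i j * (G i1 i1 l + G i2 i2 l)).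
Proof. unfold dot, D, dm, cross. rewrite !Hyy. unfold m, cross. ring. Qed.

(** The last term comes from the derivative of the normal: [m] is orthogonal to [y i1], so
    [dm l . y_1 = - m . y_1l]. *)
Lemma dot_D_tangent i j l dG dh : dot (D i j l dG dh) (y i1) =
  (dG i1 + G i1 i1 l * G i1 i j + G i1 i2 l * G i2 i j) * dot (y i1) (y i1)
  + (dG i2 + G i2 i1 l * G i1 i j + G i2 i2 l * G i2 i j) * dot (y i1) (y i2)
  - h i j * h i1 l * dot m m.
Proof.
unfold dot, D, dm, cross. rewrite !Hyy. unfold m, cross. ring.
Qed.

End Integrability.

(** * Gauss and Codazzi equations of a surface *)

Section SurfaceInSpace.

Variables (V : region) (y : idx -> coord -> field).
Variables (yy : idx -> idx -> coord -> field) (yyy : idx -> idx -> idx -> coord -> field).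
Variables (g : metric) (L M N : field).
Let h (i j : idx) : field :=
  match i, j with i1, i1 => L | i2, i2 => N | _, _ => M end.
Let at_ {A B : Type} (a : A -> B -> field) (t x1 x2 : R) (i : A) (c : B) : R :=
  a i c t x1 x2.
Let m t x1 x2 := cross (at_ y t x1 x2 i1) (at_ y t x1 x2 i2).

Hypothesis (HV : open V).
Hypothesis (Hy : forall i j c t x1 x2, V (t, x1, x2) ->
  is_pd (axis_of j) (y i c) t x1 x2 (yy i j c t x1 x2)).
Hypothesis (Hyy : forall i j l c t x1 x2, V (t, x1, x2) ->
  is_pd (axis_of l) (yy i j c) t x1 x2 (yyy i j l c t x1 x2)).
Hypothesis (Syy : forall c t x1 x2, V (t, x1, x2) ->
  yy i2 i1 c t x1 x2 = yy i1 i2 c t x1 x2).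
Hypothesis (Syyy : forall i c t x1 x2, V (t, x1, x2) ->
  yyy i i2 i1 c t x1 x2 = yyy i i1 i2 c t x1 x2).
Hypothesis (Hh : forall i j e t x1 x2, V (t, x1, x2) -> ex_pd (axis_of e) (h i j) t x1 x2).
Hypothesis (Hg : forall i j t x1 x2, V (t, x1, x2) ->
  g i j t x1 x2 = dot (at_ y t x1 x2 i) (at_ y t x1 x2 j)).
Hypothesis (Hm : forall t x1 x2, V (t, x1, x2) ->
  0 < dot (m t x1 x2) (m t x1 x2)).
Hypothesis (Hnormal : forall i j t x1 x2, V (t, x1, x2) ->
  dot (at_ (yy i) t x1 x2 j) (m t x1 x2)
  = h i j t x1 x2 * dot (m t x1 x2) (m t x1 x2)).

Let gdot (i j : idx) : field := fun t x1 x2 =>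
  y i co1 t x1 x2 * y j co1 t x1 x2 + y i co2 t x1 x2 * y j co2 t x1 x2
  + y i co3 t x1 x2 * y j co3 t x1 x2.

Let cdot (i j l : idx) : field := fun t x1 x2 =>
  yy i j co1 t x1 x2 * y l co1 t x1 x2 + yy i j co2 t x1 x2 * y l co2 t x1 x2
  + yy i j co3 t x1 x2 * y l co3 t x1 x2.

Lemma surface_det t x1 x2 : V (t, x1, x2) ->
  det_metric g t x1 x2 = dot (m t x1 x2) (m t x1 x2).
Proof.
intros Hq. unfold det_metric. rewrite !Hg by exact Hq.
unfold m. rewrite dot_cross_self. unfold dot. ring.
Qed.

Lemma surface_pd_metric i j l t x1 x2 : V (t, x1, x2) ->
  pd l (g i j) t x1 x2 = cdot i l j t x1 x2 + cdot j l i t x1 x2.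
Proof.
intros Hq. apply is_pd_pd.
apply (open_is_pd_ext V _ (gdot i j)); auto.
{ intros. symmetry. now apply Hg. }
eapply eq_rect; [unfold gdot; apply is_pd_plus; [apply is_pd_plus|];
  apply is_pd_mult; apply Hy, Hq|].
unfold cdot. ring.
Qed.

(** Christoffel symbols as rational expressions in [y] and [yy], which the rules for [is_pd] can
    differentiate; [christoffel] itself contains derivatives of [g]. *)
Let gam (k i j : idx) : field := fun t x1 x2 =>
  match k with
  | i1 => gdot i2 i2 t x1 x2 * cdot i j i1 t x1 x2
          + - (gdot i1 i2 t x1 x2 * cdot i j i2 t x1 x2)
  | i2 => gdot i1 i1 t x1 x2 * cdot i j i2 t x1 x2
          + - (gdot i1 i2 t x1 x2 * cdot i j i1 t x1 x2)
  end * / (gdot i1 i1 t x1 x2 * gdot i2 i2 t x1 x2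
           + - (gdot i1 i2 t x1 x2 * gdot i1 i2 t x1 x2)).

Lemma surface_gdet t x1 x2 :
  gdot i1 i1 t x1 x2 * gdot i2 i2 t x1 x2
  + - (gdot i1 i2 t x1 x2 * gdot i1 i2 t x1 x2) = dot (m t x1 x2) (m t x1 x2).
Proof. unfold m. rewrite dot_cross_self. reflexivity. Qed.

Lemma cdot_sym i j l t x1 x2 : V (t, x1, x2) ->
  cdot i j l t x1 x2 = cdot j i l t x1 x2.
Proof.
intros Hq. unfold cdot. destruct i, j; try reflexivity; now rewrite !Syy.
Qed.

Lemma surface_christoffel k i j t x1 x2 : V (t, x1, x2) ->
  christoffel g k i j t x1 x2 = gam k i j t x1 x2.
Proof.
intros Hq.
assert (Gg : forall i j, g i j t x1 x2 = gdot i j t x1 x2) by (intros; now apply Hg).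
assert (S1 := cdot_sym i2 i1). assert (Hm' := Hm _ _ _ Hq).
assert (E : forall i j l, pd i (g j l) t x1 x2 + pd j (g i l) t x1 x2
  - pd l (g i j) t x1 x2 = 2 * cdot i j l t x1 x2).
{ intros. rewrite !surface_pd_metric by exact Hq.
  rewrite (cdot_sym j0 i0 l), (cdot_sym l i0 j0), (cdot_sym l j0 i0) by exact Hq. ring. }
unfold christoffel, sum_idx. rewrite !E.
unfold inv_metric. rewrite !surface_det by exact Hq.
rewrite !Gg. unfold gam. rewrite surface_gdet.
assert (S2 : gdot i2 i1 t x1 x2 = gdot i1 i2 t x1 x2) by (unfold gdot; ring).
destruct k; rewrite ?Gg, ?S2; field; lra.
Qed.

Lemma surface_christoffel_ex_pd k i j e t x1 x2 : V (t, x1, x2) ->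
  ex_pd (axis_of e) (christoffel g k i j) t x1 x2.
Proof.
intros Hq.
assert (E : exists l, is_pd (axis_of e) (gam k i j) t x1 x2 l).
{ assert (Hgd : forall i j, exists l, is_pd (axis_of e) (gdot i j) t x1 x2 l).
  { intros. eexists. unfold gdot. apply is_pd_plus; [apply is_pd_plus|];
      apply is_pd_mult; apply Hy, Hq. }
  assert (Hcd : forall i j l, exists d, is_pd (axis_of e) (cdot i j l) t x1 x2 d).
  { intros. eexists. unfold cdot. apply is_pd_plus; [apply is_pd_plus|];
      apply is_pd_mult; solve [apply Hyy, Hq|apply Hy, Hq]. }
  destruct (Hgd i1 i1) as [? D11], (Hgd i1 i2) as [? D12], (Hgd i2 i2) as [? D22].
  destruct (Hcd i j i1) as [? C1], (Hcd i j i2) as [? C2].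
  assert (Hm' := Hm _ _ _ Hq).
  destruct k; eexists; unfold gam; (apply is_pd_mult;
    [apply is_pd_plus; [|apply is_pd_opp]; apply is_pd_mult; eassumption
    |apply is_pd_inv;
     [apply is_pd_plus; [|apply is_pd_opp]; apply is_pd_mult; eassumption
     |rewrite surface_gdet; lra]]). }
destruct E as [l E]. exists l.
apply (open_is_pd_ext V _ (gam k i j)); auto.
intros. symmetry. now apply surface_christoffel.
Qed.

Lemma surface_hessian i j c t x1 x2 : V (t, x1, x2) ->
  yy i j c t x1 x2 = christoffel g i1 i j t x1 x2 * y i1 c t x1 x2
    + christoffel g i2 i j t x1 x2 * y i2 c t x1 x2
    + h i j t x1 x2 * m t x1 x2 c.
Proof.
intros Hq. rewrite !surface_christoffel by exact Hq.
assert (F := frame_expansion (at_ y t x1 x2 i1) (at_ y t x1 x2 i2)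
  (at_ (yy i) t x1 x2 j) c).
change (cross (at_ y t x1 x2 i1) (at_ y t x1 x2 i2)) with (m t x1 x2) in F.
rewrite Hnormal in F by exact Hq.
assert (Hm' := Hm _ _ _ Hq). set (n := dot (m t x1 x2) (m t x1 x2)) in *.
apply Rmult_eq_reg_l with n; [|lra].
change (yy i j c t x1 x2) with (at_ (yy i) t x1 x2 j c). rewrite F.
unfold gam. rewrite surface_gdet. fold n.
unfold dot, gdot, cdot, at_. field. lra.
Qed.

(** The surface enters through its tangent fields; [Syy] is the condition for them to be partial
    derivatives of a position. Symmetry of the third derivatives is then read in the moving
    frame. *)
Theorem surface_gauss_codazzi t x1 x2 : V (t, x1, x2) ->
  gauss_codazzi_at g L M N t x1 x2.
Proof.
intros Hq.
pose (G k i j := christoffel g k i j t x1 x2).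
pose (hv i j := h i j t x1 x2).
assert (HG : forall k, G k i2 i1 = G k i1 i2).
{ intros k. unfold G. rewrite !surface_christoffel by exact Hq.
  unfold gam. rewrite !(cdot_sym i2 i1) by exact Hq. reflexivity. }
assert (Hess : forall i j c, at_ (yy i) t x1 x2 j c
  = G i1 i j * at_ y t x1 x2 i1 c + G i2 i j * at_ y t x1 x2 i2 c
    + hv i j * m t x1 x2 c).
{ intros. now apply surface_hessian. }
set (y0 := at_ y t x1 x2) in *. set (yy0 := fun i => at_ (yy i) t x1 x2).
set (dG := fun i j l k => pd l (christoffel g k i j) t x1 x2).
set (dh := fun i j l => pd l (h i j) t x1 x2).
assert (D : forall i j l c, yyy i j l c t x1 x2 =
  dG i j l i1 * y0 i1 c + G i1 i j * yy0 i1 l c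
  + (dG i j l i2 * y0 i2 c + G i2 i j * yy0 i2 l c)
  + (dh i j l * m t x1 x2 c + hv i j *
      (cross (yy0 i1 l) (y0 i2) c + cross (y0 i1) (yy0 i2 l) c))).
{ intros i j l c. apply is_pd_eq with (axis_of l)
    (fun t x1 x2 => christoffel g i1 i j t x1 x2 * y i1 c t x1 x2
    + christoffel g i2 i j t x1 x2 * y i2 c t x1 x2
    + h i j t x1 x2 * m t x1 x2 c) t x1 x2.
  - apply is_pd_plus; [apply is_pd_plus|]; apply is_pd_mult;
      try (apply ex_pd_correct, surface_christoffel_ex_pd, Hq);
      try (apply Hy, Hq).
    + apply ex_pd_correct, Hh, Hq.
    + unfold m, cross, yy0, y0, at_. destruct c.
      * eapply eq_rect; [apply is_pd_plus; [|apply is_pd_opp];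
          apply is_pd_mult; apply Hy, Hq|]. ring.
      * eapply eq_rect; [apply is_pd_plus; [|apply is_pd_opp];
          apply is_pd_mult; apply Hy, Hq|]. ring.
      * eapply eq_rect; [apply is_pd_plus; [|apply is_pd_opp];
          apply is_pd_mult; apply Hy, Hq|]. ring.
  - apply (open_is_pd_ext V _ (yy i j c)); auto.
    intros. now apply surface_hessian. }
assert (S3 : forall l c, yyy i2 i1 l c t x1 x2 = yyy i1 i2 l c t x1 x2).
{ intros l c. apply is_pd_eq with (axis_of l) (yy i1 i2 c) t x1 x2; auto.
  apply (open_is_pd_ext V _ (yy i2 i1 c)); auto. }
assert (E1 : forall c, yyy i2 i2 i1 c t x1 x2 = yyy i1 i2 i2 c t x1 x2).
{ intros c. now rewrite Syyy, S3. }
assert (E2 : forall c, yyy i1 i1 i2 c t x1 x2 = yyy i1 i2 i1 c t x1 x2).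
{ intros c. now rewrite Syyy. }
assert (Hn := dot_D_normal y0 yy0 G hv Hess).
assert (Ht := dot_D_tangent y0 yy0 G hv Hess).
assert (Hdot : forall a a' b, (forall c, a c = a' c) -> dot a b = dot a' b).
{ intros a a' b Ha. unfold dot. now rewrite !Ha. }
(* [T1] is [d_1 y_22 = d_2 y_12] and [T2] is [d_2 y_11 = d_1 y_12]. Their normal components are the
   two Codazzi equations; [T1] against [y_1] is the Gauss equation. *)
assert (T1 := fun w => Hdot _ _ w (fun c => eq_trans (eq_sym (D i2 i2 i1 c))
  (eq_trans (E1 c) (D i1 i2 i2 c)))).
assert (T2 := fun w => Hdot _ _ w (fun c => eq_trans (eq_sym (D i1 i1 i2 c))
  (eq_trans (E2 c) (D i1 i2 i1 c)))).
assert (P1 := T1 (m t x1 x2)). assert (P2 := T2 (m t x1 x2)).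
assert (P3 := T1 (y0 i1)).
change (m t x1 x2) with (cross (y0 i1) (y0 i2)) in P1, P2, P3.
rewrite !Hn in P1, P2. rewrite !Ht in P3.
change (cross (y0 i1) (y0 i2)) with (m t x1 x2) in P1, P2, P3.
assert (Hm' := Hm _ _ _ Hq). set (n := dot (m t x1 x2) (m t x1 x2)) in *.
apply Rmult_eq_reg_l in P1; [|lra]. apply Rmult_eq_reg_l in P2; [|lra].
rewrite ?(HG i1), ?(HG i2) in P1, P2.
unfold gauss_codazzi_at.
change (christoffel g ?k ?i ?j t x1 x2) with (G k i j).
change (L t x1 x2) with (hv i1 i1). change (N t x1 x2) with (hv i2 i2).
change (M t x1 x2) with (hv i1 i2).
change (hv i2 i1) with (hv i1 i2) in P1, P2, P3.
change (pd i1 N t x1 x2) with (dh i2 i2 i1).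
change (pd i2 M t x1 x2) with (dh i1 i2 i2).
change (pd i1 M t x1 x2) with (dh i1 i2 i1).
change (pd i2 L t x1 x2) with (dh i1 i1 i2).
split; [lra|]. split; [lra|].
unfold gauss_curvature. rewrite surface_det by exact Hq. fold n.
apply Rmult_eq_reg_r with n; [|lra].
unfold Rdiv. rewrite Rmult_assoc, Rinv_l, Rmult_1_r by lra.
unfold sum_idx, riemann, sum_idx.
change (christoffel g ?k ?i ?j t x1 x2) with (G k i j).
change (pd ?l (christoffel g ?k ?i ?j) t x1 x2) with (dG i j l k).
rewrite !Hg by exact Hq. fold y0. rewrite ?(HG i1), ?(HG i2).
rewrite (HG i1), (HG i2) in P3. lra.
Qed.

End SurfaceInSpace.

(** * The system for the surface *)

(** Turns an equation between coefficients with [j = 0] into an equation between fields on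
    [x1 = a1]. *)
Lemma ev_restrict_1 f g v : v ax1 = 0 ->
  (forall i k, f i O k = g i O k) -> ev f v = ev g v.
Proof.
intros Hv H. unfold ev. apply Series_ext. intros n. unfold coef. f_equal.
assert (E : forall i k, dirDn v n f i O k = dirDn v n g i O k).
{ induction n as [|n IH]; intros i k; simpl; [apply H|].
  unfold dirD, jadd, jscal, shift. rewrite Hv, !IH. ring. }
apply E.
Qed.

Lemma ev_restrict_12 f g v : v ax1 = 0 -> v ax2 = 0 ->
  (forall i, f i O O = g i O O) -> ev f v = ev g v.
Proof.
intros Hv1 Hv2 H. unfold ev. apply Series_ext. intros n. unfold coef. f_equal.
assert (E : forall i, dirDn v n f i O O = dirDn v n g i O O).
{ induction n as [|n IH]; intros i; simpl; [apply H|].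
  unfold dirD, jadd, jscal, shift. rewrite Hv1, Hv2, !IH. ring. }
apply E.
Qed.

Lemma jfield_center a1 a2 f : jfield a1 a2 f 0 a1 a2 = f O O O.
Proof.
unfold jfield. rewrite !Rminus_diag. rewrite <- (ev_jconst (f O O O) (vec 0 0 0)).
unfold ev. apply Series_ext. intros n. unfold coef. f_equal.
destruct n as [|n]; [reflexivity|].
simpl. unfold dirD, jadd, jscal. simpl. ring.
Qed.

Section JetFields.

Variables (a1 a2 r : R) (f g : jet) (t x1 x2 : R).
Hypothesis (Hq : dist1 a1 a2 t x1 x2 < r).

Lemma jfield_add : conv r f -> conv r g ->
  jfield a1 a2 (jadd f g) t x1 x2 = jfield a1 a2 f t x1 x2 + jfield a1 a2 g t x1 x2.
Proof. intros Hf Hg. now apply (ev_jadd r). Qed.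

Lemma jfield_mul : conv r f -> conv r g ->
  jfield a1 a2 (jmul f g) t x1 x2 = jfield a1 a2 f t x1 x2 * jfield a1 a2 g t x1 x2.
Proof. intros Hf Hg. now apply (ev_jmul r). Qed.

Lemma jfield_scal c :
  jfield a1 a2 (jscal c f) t x1 x2 = c * jfield a1 a2 f t x1 x2.
Proof. apply ev_jscal. Qed.

Lemma jfield_const c : jfield a1 a2 (jconst c) t x1 x2 = c.
Proof. apply ev_jconst. Qed.

End JetFields.

Lemma jfield_pos_near a1 a2 r f : 0 < r -> conv r f -> 0 < f O O O ->
  locally (0, a1, a2) (fun q : R * R * R =>
    0 < jfield a1 a2 f (fst (fst q)) (snd (fst q)) (snd q)).
Proof.
intros Hr Hf H0.
assert (Hd : dist1 a1 a2 0 a1 a2 < r).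
{ unfold dist1, norm1. simpl. rewrite !Rminus_diag, !Rabs_R0. lra. }
assert (C := jfield_continuous r a1 a2 f 0 a1 a2 Hf Hd).
apply (C (fun z => 0 < z)). simpl. rewrite jfield_center.
apply (open_gt 0), H0.
Qed.

Inductive unknown := Us | Up | Uq | Ua | Ub | UX | UY | Usig.

Section System.

Variables (gamma : R) (rho u v : jet).

Local Notation "f ** g" := (jmul f g) (at level 40, left associativity).
Local Notation "f ++ g" := (jadd f g).

Let state := unknown -> jet.

Definition jM : jet := jscal (-1) (rho ** (u ** v)).
Definition jL (Z : state) : jet := rho ** (v ** v) ++ Z Up.
Definition jN (Z : state) : jet := rho ** (u ** u) ++ Z Up.
(** This is [(L N - M^2) / N] once [Uq] is known to be [1 / N]. *)
Definition jG (Z : state) : jet := jL Z ++ jscal (-1) (jM ** (jM ** Z Uq)).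
Definition jw (Z : state) : jet := jconst 1 ++ (Z Ua ** Z Ua ++ Z Ub ** Z Ub).

(** The power law [p = rho^gamma / gamma] in polynomial form: [p_e = gamma p rho_e / rho]. *)
Definition dp (e : axis) (Z : state) : jet :=
  jscal gamma (Z Up ** (Z Us ** shift e rho)).

(** The [ax2] and [axt] cases are the derivatives of the Cauchy data; likewise in [db] and
    [system]. *)
Definition da (e : axis) (Z : state) : jet :=
  match e with
  | ax1 => Z Uq ** jM ** shift ax2 (Z Ua)
           ++ jscal (-1) (jG Z ** (jw Z ** shift ax2 (Z UY)))
  | ax2 => jconst 1
  | axt => jconst 0
  end.

Definition db (e : axis) (Z : state) : jet :=
  match e with
  | ax1 => Z Uq ** jM ** shift ax2 (Z Ub) ++ jG Z ** (jw Z ** shift ax2 (Z UX))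
  | _ => jconst 0
  end.

(** [Us] is [1 / rho], [Up] the pressure, [Uq] is [1 / N], [Usig] is
    [1 / (1 + a^2 + b^2)]; [(a, b, 1)] is normal to the surface [(X, Y, f)]. *)
Definition system (e : axis) (m : unknown) (Z : state) : jet :=
  match m with
  | Us => Z Us ** (Z Us ** jscal (-1) (shift e rho))
  | Up => dp e Z
  | Uq => Z Uq ** (Z Uq ** jscal (-1) (u ** u ** shift e rho
            ++ (jscal 2 (rho ** u ** shift e u) ++ dp e Z)))
  | Ua => da e Z
  | Ub => db e Z
  | UX => match e with
          | ax1 => Z Uq ** jM ** shift ax2 (Z UX)
                   ++ jscal (-1) (Z Uq ** Z Usig ** shift ax2 (Z Ub))
          | ax2 => jconst (-1)
          | axt => jconst 0
          end
  | UY => match e with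
          | ax1 => Z Uq ** jM ** shift ax2 (Z UY)
                   ++ Z Uq ** Z Usig ** shift ax2 (Z Ua)
          | _ => jconst 0
          end
  | Usig => Z Usig ** Z Usig ** jscal (-2) (Z Ua ** da e Z ++ Z Ub ** db e Z)
  end.

Definition initial (m : unknown) : R :=
  match m with
  | Us => / rho O O O
  | Up => Rpower (rho O O O) gamma / gamma
  | Uq => / (rho O O O * (u O O O * u O O O) + Rpower (rho O O O) gamma / gamma)
  | Usig => 1
  | _ => 0
  end.

Definition is_ax1 (e : axis) : bool := match e with ax1 => true | _ => false end.

(** The products in [system] are grouped so that only the right factor contains derivatives, as
    [op1_mul] demands. *)
Lemma system_op1 r e m : 0 < r ->
  dominated (phi r) rho -> dominated (phi r) u -> dominated (phi r) v ->
  op1 unknown r (is_ax1 e) (system e m).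
Proof.
intros Hr Hrho Hu Hv.
assert (K0 : forall f, dominated (phi r) f -> op0 unknown r (fun _ => f))
  by (intros; now apply op0_known).
assert (K1 : forall b c, op1 unknown r b (fun _ => jconst c))
  by (intros; apply op1_known; now apply dominated_derive_jconst).
assert (KC : forall c, op0 unknown r (fun _ => jconst c))
  by (intros; apply op0_known; now apply dominated_jconst).
assert (KD : forall b e f, dominated (phi r) f -> op1 unknown r b (fun _ => shift e f))
  by (intros; apply op1_known; now apply dominated_shift).
assert (KM : op0 unknown r (fun _ => jM))
  by (unfold jM; apply (op0_scal unknown r (-1) (fun _ => rho ** (u ** v))),
        (op0_mul unknown r (fun _ => rho) (fun _ => u ** v));
      [auto|apply (op0_mul unknown r (fun _ => u) (fun _ => v)); auto]).
assert (Kuu : op0 unknown r (fun _ => u ** u))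
  by (apply (op0_mul unknown r (fun _ => u) (fun _ => u)); auto).
assert (Kvv : op0 unknown r (fun _ => v ** v))
  by (apply (op0_mul unknown r (fun _ => v) (fun _ => v)); auto).
assert (Kru : op0 unknown r (fun _ => rho ** u))
  by (apply (op0_mul unknown r (fun _ => rho) (fun _ => u)); auto).
assert (Var := op0_var unknown r).
assert (KL : op0 unknown r jL).
{ unfold jL. apply (op0_add unknown r (fun _ => rho ** (v ** v)) (fun Z => Z Up)); auto.
  apply (op0_mul unknown r (fun _ => rho) (fun _ => v ** v)); auto. }
assert (KG : op0 unknown r jG).
{ unfold jG. apply op0_add; auto. apply op0_scal.
  apply (op0_mul unknown r (fun _ => jM)); auto.
  apply (op0_mul unknown r (fun _ => jM)); auto. }
assert (Kw : op0 unknown r jw).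
{ unfold jw. apply (op0_add unknown r (fun _ => jconst 1)); auto.
  apply op0_add; apply op0_mul; auto. }
assert (KqM : op0 unknown r (fun Z => Z Uq ** jM)).
{ apply (op0_mul unknown r (fun Z => Z Uq) (fun _ => jM)); auto. }
assert (Kqs : op0 unknown r (fun Z => Z Uq ** Z Usig)) by (apply op0_mul; auto).
assert (D := op1_deriv unknown r).
assert (Kp : op1 unknown r (is_ax1 e) (dp e)).
{ unfold dp. apply op1_scal, op1_mul; auto.
  apply (op1_mul unknown r _ (fun Z => Z Us) (fun _ => shift e rho)); auto. }
assert (Ka : op1 unknown r (is_ax1 e) (da e)).
{ unfold da; destruct e; simpl; auto.
  apply op1_add; [apply op1_mul; auto|].
  apply op1_scal. apply op1_mul; auto. apply op1_mul; auto. }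
assert (Kb : op1 unknown r (is_ax1 e) (db e)).
{ unfold db; destruct e; simpl; auto.
  apply op1_add; [apply op1_mul; auto|]. apply op1_mul; auto. apply op1_mul; auto. }
destruct m; unfold system; auto.
- apply op1_mul; auto.
  apply (op1_mul unknown r _ (fun Z => Z Us) (fun _ => jscal (-1) (shift e rho))); auto.
  apply (op1_scal unknown r _ (-1) (fun _ => shift e rho)); auto.
- apply op1_mul; auto. apply op1_mul; auto. apply op1_scal.
  apply (op1_add unknown r _ (fun _ => u ** u ** shift e rho)).
  + apply (op1_mul unknown r _ (fun _ => u ** u) (fun _ => shift e rho)); auto.
  + apply (op1_add unknown r _ (fun _ => jscal 2 (rho ** u ** shift e u))); auto.
    apply (op1_scal unknown r _ 2 (fun _ => rho ** u ** shift e u)).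
    apply (op1_mul unknown r _ (fun _ => rho ** u) (fun _ => shift e u)); auto.
- destruct e; simpl; auto.
  apply op1_add; [apply op1_mul; auto|]. apply op1_scal, op1_mul; auto.
- destruct e; simpl; auto.
  apply op1_add; [apply op1_mul; auto|]. apply op1_mul; auto.
- apply op1_mul; [apply op0_mul; auto|]. apply op1_scal.
  apply op1_add; apply op1_mul; auto.
Qed.

Lemma system_solution r : 0 < r ->
  dominated (phi r) rho -> dominated (phi r) u -> dominated (phi r) v ->
  exists (Z : state) (r0 : R), 0 < r0 /\
    conv r0 rho /\ conv r0 u /\ conv r0 v /\ (forall m, conv r0 (Z m)) /\
    (forall m, Z m O O O = initial m) /\
    (forall m, shift ax1 (Z m) = system ax1 m Z) /\
    (forall m i k, shift ax2 (Z m) i O k = system ax2 m Z i O k) /\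
    (forall m i, shift axt (Z m) i O O = system axt m Z i O O).
Proof.
intros Hr Hrho Hu Hv.
destruct (cauchy_problem_jets unknown r Hr (Us :: Up :: Uq :: Ua :: Ub :: UX :: UY :: Usig :: nil)
  (system ax1) (system ax2) (system axt) initial)
  as [Z [[B [A [K [HB [HA [HK HZ]]]]]] [E1 [E2 [Et E0]]]]].
- intros []; simpl; tauto.
- intros m. now apply (system_op1 r ax1).
- intros m. now apply (system_op1 r ax2).
- intros m. now apply (system_op1 r axt).
- assert (Hd : 0 < r * (A * K)).
  { apply Rmult_lt_0_compat; [exact Hr|]. apply Rmult_lt_0_compat; lra. }
  assert (HAK : 1 <= A * K) by nra.
  assert (C : forall f, dominated (phi r) f -> conv (/ (r * (A * K))) f).
  { intros f [c [Hc Hf]]. apply (conv_of_maj c 1 1 r); try lra; [|exact Hf].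
    apply Rmult_le_reg_l with (r * (A * K)); [exact Hd|].
    rewrite <- Rmult_assoc, Rinv_r by lra. nra. }
  exists Z, (/ (r * (A * K))). repeat split; auto.
  + now apply Rinv_0_lt_compat.
  + intros m. apply (conv_of_maj B A K r); auto; try lra.
    rewrite Rinv_l; lra.
Qed.

End System.

(** * The surface defined by a solution of the system *)

Section Solution.

Variables (gamma : R) (rho u v : jet) (Z : unknown -> jet) (r eps a1 a2 : R).
Hypothesis (Hgamma : 0 < gamma).
Hypothesis (Heps : 0 < eps).
Hypothesis (Hr : 3 * eps <= r).
Hypothesis (Crho : conv r rho).
Hypothesis (Cu : conv r u).
Hypothesis (Cv : conv r v).
Hypothesis (CZ : forall m, conv r (Z m)).
Hypothesis (Z0 : forall m, Z m O O O = initial gamma rho u m).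
Hypothesis (Z1 : forall m, shift ax1 (Z m) = system gamma rho u v ax1 m Z).
Hypothesis (Z2 : forall m i k,
  shift ax2 (Z m) i O k = system gamma rho u v ax2 m Z i O k).
Hypothesis (Zt : forall m i,
  shift axt (Z m) i O O = system gamma rho u v axt m Z i O O).

Let E (f : jet) : field := jfield a1 a2 f.
Let B := box a1 a2 eps.

Hypothesis (Prho : forall t x1 x2, B t x1 x2 -> 0 < E rho t x1 x2).
Hypothesis (PZ : forall m t x1 x2,
  match m with Us | Up | Uq | Usig => True | _ => False end ->
  B t x1 x2 -> 0 < E (Z m) t x1 x2).

Let HB t x1 x2 (Hq : B t x1 x2) : dist1 a1 a2 t x1 x2 < r :=
  dist1_box a1 a2 eps r t x1 x2 Hr Hq.

Ltac conv_tac :=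
  repeat first [assumption | apply CZ | apply conv_jmul | apply conv_jadd
    | apply conv_jscal | apply conv_jconst | apply conv_shift].

Lemma E_add f g t x1 x2 : B t x1 x2 -> conv r f -> conv r g ->
  E (jadd f g) t x1 x2 = E f t x1 x2 + E g t x1 x2.
Proof. intros Hq. apply jfield_add. now apply HB. Qed.

Lemma E_mul f g t x1 x2 : B t x1 x2 -> conv r f -> conv r g ->
  E (jmul f g) t x1 x2 = E f t x1 x2 * E g t x1 x2.
Proof. intros Hq. apply jfield_mul. now apply HB. Qed.

Lemma E_scal c f t x1 x2 : E (jscal c f) t x1 x2 = c * E f t x1 x2.
Proof. apply jfield_scal. Qed.

Lemma E_const c t x1 x2 : E (jconst c) t x1 x2 = c.
Proof. apply jfield_const. Qed.

Lemma E_pd e f t x1 x2 : B t x1 x2 -> conv r f ->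
  is_pd e (E f) t x1 x2 (E (shift e f) t x1 x2).
Proof. intros Hq Hf. apply (jfield_is_pd r); auto. Qed.

Lemma unknown_pd e m t x1 x2 : B t x1 x2 -> prescribed a1 a2 e x1 x2 ->
  is_pd e (E (Z m)) t x1 x2 (E (system gamma rho u v e m Z) t x1 x2).
Proof.
intros Hq He.
replace (E (system gamma rho u v e m Z) t x1 x2) with (E (shift e (Z m)) t x1 x2).
{ now apply E_pd. }
unfold E, jfield. destruct e; simpl in He.
- destruct He as [-> ->]. apply ev_restrict_12; [apply Rminus_diag|apply Rminus_diag|apply Zt].
- now rewrite Z1.
- subst x1. apply ev_restrict_1; [apply Rminus_diag|apply Z2].
Qed.

Ltac E_simpl Hq := repeat first
  [ rewrite (E_add _ _ _ _ _ Hq) by conv_tac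
  | rewrite (E_mul _ _ _ _ _ Hq) by conv_tac
  | rewrite E_scal | rewrite E_const ].

(** Passing to the reciprocal of the unknown makes the derivatives of both sides equal outright, so
    their difference is constant. The same device serves for [1 / N] and [1 / (1 + a^2 + b^2)], and
    logarithms for the pressure. *)
Lemma solution_inv_rho t x1 x2 : B t x1 x2 ->
  E (Z Us) t x1 x2 = / E rho t x1 x2.
Proof.
intros Hq.
assert (K := prescribed_constant a1 a2 eps
  (fun t x1 x2 => / E (Z Us) t x1 x2 + - E rho t x1 x2) Heps).
assert (P0 := Prho _ _ _ Hq). assert (P1 := PZ Us _ _ _ I Hq).
enough (G : / E (Z Us) t x1 x2 + - E rho t x1 x2 = 0).
{ replace (E rho t x1 x2) with (/ E (Z Us) t x1 x2) by lra. now rewrite Rinv_inv. }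
rewrite K; [| |exact Hq].
- unfold E. rewrite !jfield_center, Z0. simpl. rewrite Rinv_inv. ring.
- clear t x1 x2 Hq P0 P1 K. intros e t x1 x2 Hq He.
  assert (P1 := PZ Us _ _ _ I Hq).
  eapply eq_rect.
  + apply is_pd_plus; [apply is_pd_inv; [now apply unknown_pd|lra]|].
    apply is_pd_opp, E_pd; auto.
  + simpl system. E_simpl Hq. field. lra.
Qed.

Lemma solution_pressure t x1 x2 : B t x1 x2 ->
  E (Z Up) t x1 x2 = Rpower (E rho t x1 x2) gamma / gamma.
Proof.
intros Hq.
assert (K := prescribed_constant a1 a2 eps
  (fun t x1 x2 => ln (E (Z Up) t x1 x2) + - (gamma * ln (E rho t x1 x2))) Heps).
assert (P0 := Prho _ _ _ Hq). assert (P1 := PZ Up _ _ _ I Hq).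
assert (L : forall x, ln (Rpower x gamma / gamma) = gamma * ln x - ln gamma).
{ intros x. unfold Rdiv, Rpower.
  rewrite ln_mult, ln_exp, ln_Rinv by (auto using exp_pos, Rinv_0_lt_compat). ring. }
apply ln_inv; [exact P1| |].
{ apply Rdiv_lt_0_compat; [apply exp_pos|exact Hgamma]. }
rewrite L.
enough (G : ln (E (Z Up) t x1 x2) + - (gamma * ln (E rho t x1 x2)) = - ln gamma) by lra.
rewrite K; [| |exact Hq].
- unfold E. rewrite !jfield_center, Z0. simpl. rewrite L. ring.
- clear t x1 x2 Hq P0 P1 K. intros e t x1 x2 Hq He.
  assert (P0 := Prho _ _ _ Hq). assert (P1 := PZ Up _ _ _ I Hq).
  eapply eq_rect.
  + apply is_pd_plus; [apply is_pd_ln; [now apply unknown_pd|exact P1]|].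
    apply is_pd_opp, is_pd_mult; [apply is_pd_const|].
    apply is_pd_ln; [now apply E_pd|exact P0].
  + simpl system. unfold dp. E_simpl Hq. rewrite solution_inv_rho by exact Hq.
    field. lra.
Qed.

Lemma solution_inv_N t x1 x2 : B t x1 x2 ->
  E (Z Uq) t x1 x2 * (E rho t x1 x2 * E u t x1 x2 ^ 2 + E (Z Up) t x1 x2) = 1.
Proof.
intros Hq.
assert (K := prescribed_constant a1 a2 eps
  (fun t x1 x2 => / E (Z Uq) t x1 x2
    + - (E rho t x1 x2 * (E u t x1 x2 * E u t x1 x2) + E (Z Up) t x1 x2)) Heps).
assert (P1 := PZ Uq _ _ _ I Hq).
enough (G : / E (Z Uq) t x1 x2
    + - (E rho t x1 x2 * (E u t x1 x2 * E u t x1 x2) + E (Z Up) t x1 x2) = 0).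
{ replace (E rho t x1 x2 * E u t x1 x2 ^ 2 + E (Z Up) t x1 x2)
    with (/ E (Z Uq) t x1 x2) by (simpl; lra). apply Rinv_r. lra. }
rewrite K; [| |exact Hq].
- unfold E. rewrite !jfield_center, !Z0. simpl. rewrite Rinv_inv. ring.
- clear t x1 x2 Hq P1 K. intros e t x1 x2 Hq He.
  assert (P1 := PZ Uq _ _ _ I Hq).
  eapply eq_rect.
  + apply is_pd_plus; [apply is_pd_inv; [now apply unknown_pd|lra]|].
    apply is_pd_opp, is_pd_plus; [|now apply unknown_pd].
    apply is_pd_mult; [now apply E_pd|].
    apply is_pd_mult; now apply E_pd.
  + simpl system. unfold dp. E_simpl Hq. field. lra.
Qed.

Lemma solution_sigma t x1 x2 : B t x1 x2 ->
  E (Z Usig) t x1 x2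
    * (1 + (E (Z Ua) t x1 x2 * E (Z Ua) t x1 x2 + E (Z Ub) t x1 x2 * E (Z Ub) t x1 x2))
  = 1.
Proof.
intros Hq.
assert (K := prescribed_constant a1 a2 eps
  (fun t x1 x2 => / E (Z Usig) t x1 x2
    + - (E (Z Ua) t x1 x2 * E (Z Ua) t x1 x2
         + E (Z Ub) t x1 x2 * E (Z Ub) t x1 x2)) Heps).
assert (P1 := PZ Usig _ _ _ I Hq).
enough (G : / E (Z Usig) t x1 x2
    + - (E (Z Ua) t x1 x2 * E (Z Ua) t x1 x2
         + E (Z Ub) t x1 x2 * E (Z Ub) t x1 x2) = 1).
{ set (s := E (Z Usig) t x1 x2) in *. set (w := _ * _ + _ * _) in *.
  replace (1 + w) with (/ s) by lra. apply Rinv_r. lra. }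
rewrite K; [| |exact Hq].
- unfold E. rewrite !jfield_center, !Z0. simpl. field.
- clear t x1 x2 Hq P1 K. intros e t x1 x2 Hq He.
  assert (P1 := PZ Usig _ _ _ I Hq).
  assert (Ca : conv r (system gamma rho u v e Ua Z)).
  { destruct e; simpl; unfold jG, jL, jw, jM; conv_tac. }
  assert (Cb : conv r (system gamma rho u v e Ub Z)).
  { destruct e; simpl; unfold jG, jL, jw, jM; conv_tac. }
  eapply eq_rect.
  + apply is_pd_plus; [apply is_pd_inv; [now apply unknown_pd|lra]|].
    apply is_pd_opp, is_pd_plus; apply is_pd_mult; now apply unknown_pd.
  + change (system gamma rho u v e Usig Z) with
      (jmul (jmul (Z Usig) (Z Usig)) (jscal (-2)
        (jadd (jmul (Z Ua) (system gamma rho u v e Ua Z))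
              (jmul (Z Ub) (system gamma rho u v e Ub Z))))).
    E_simpl Hq. field. lra.
Qed.

Let M t x1 x2 := - (E rho t x1 x2 * E u t x1 x2 * E v t x1 x2).
Let L t x1 x2 := E rho t x1 x2 * E v t x1 x2 ^ 2 + E (Z Up) t x1 x2.
Let N t x1 x2 := E rho t x1 x2 * E u t x1 x2 ^ 2 + E (Z Up) t x1 x2.
Let q := E (Z Uq).
Let w t x1 x2 :=
  1 + (E (Z Ua) t x1 x2 * E (Z Ua) t x1 x2 + E (Z Ub) t x1 x2 * E (Z Ub) t x1 x2).
Let G t x1 x2 := L t x1 x2 - M t x1 x2 ^ 2 * q t x1 x2.
Let d e m := E (shift e (Z m)).

Lemma solution_frame t x1 x2 : B t x1 x2 ->
  d ax1 Ua t x1 x2 = q t x1 x2 * M t x1 x2 * d ax2 Ua t x1 x2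
                     - G t x1 x2 * w t x1 x2 * d ax2 UY t x1 x2 /\
  d ax1 Ub t x1 x2 = q t x1 x2 * M t x1 x2 * d ax2 Ub t x1 x2
                     + G t x1 x2 * w t x1 x2 * d ax2 UX t x1 x2 /\
  d ax1 UX t x1 x2 = q t x1 x2 * M t x1 x2 * d ax2 UX t x1 x2
                     - q t x1 x2 * E (Z Usig) t x1 x2 * d ax2 Ub t x1 x2 /\
  d ax1 UY t x1 x2 = q t x1 x2 * M t x1 x2 * d ax2 UY t x1 x2
                     + q t x1 x2 * E (Z Usig) t x1 x2 * d ax2 Ua t x1 x2.
Proof.
intros Hq. unfold d. rewrite !Z1. simpl system. unfold da, db, jG, jL, jw, jM.
E_simpl Hq. unfold G, w, L, M, q. repeat split; ring.
Qed.

(** The third component makes the tangent orthogonal to [(a, b, 1)]; the third coordinate itself is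
    not constructed. *)
Definition tangent (i : idx) (c : coord) : jet :=
  let s := shift (axis_of i) in
  match c with
  | co1 => s (Z UX)
  | co2 => s (Z UY)
  | co3 => jscal (-1) (jadd (jmul (Z Ua) (s (Z UX))) (jmul (Z Ub) (s (Z UY))))
  end.

Definition jet_metric (i j : idx) : jet :=
  jadd (jmul (tangent i co1) (tangent j co1))
    (jadd (jmul (tangent i co2) (tangent j co2)) (jmul (tangent i co3) (tangent j co3))).

Lemma conv_tangent i c : conv r (tangent i c).
Proof. destruct c; simpl; conv_tac. Qed.

Lemma conv_jet_metric i j : conv r (jet_metric i j).
Proof. unfold jet_metric. repeat first [apply conv_jadd|apply conv_jmul]; apply conv_tangent. Qed.

Let y i c := E (tangent i c).
Let yy i j c := E (shift (axis_of j) (tangent i c)).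
Let yyy i j l c := E (shift (axis_of l) (shift (axis_of j) (tangent i c))).

Lemma y_3 i t x1 x2 : B t x1 x2 -> y i co3 t x1 x2 =
  - (E (Z Ua) t x1 x2 * y i co1 t x1 x2 + E (Z Ub) t x1 x2 * y i co2 t x1 x2).
Proof. intros Hq. unfold y. simpl tangent. E_simpl Hq. ring. Qed.

Lemma yy_3 i j t x1 x2 : B t x1 x2 -> yy i j co3 t x1 x2 =
  - (d (axis_of j) Ua t x1 x2 * y i co1 t x1 x2 + E (Z Ua) t x1 x2 * yy i j co1 t x1 x2
     + (d (axis_of j) Ub t x1 x2 * y i co2 t x1 x2 + E (Z Ub) t x1 x2 * yy i j co2 t x1 x2)).
Proof.
intros Hq. unfold yy, y, d. simpl tangent.
rewrite shift_jscal, shift_jadd, !shift_jmul. E_simpl Hq. ring.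
Qed.

Let D t x1 x2 :=
  d ax2 Ua t x1 x2 * d ax2 UX t x1 x2 + d ax2 Ub t x1 x2 * d ax2 UY t x1 x2.
Let J t x1 x2 :=
  d ax1 UX t x1 x2 * d ax2 UY t x1 x2 - d ax1 UY t x1 x2 * d ax2 UX t x1 x2.

(** The [M] terms cancel. Since [y_1 x y_2 = J (a, b, 1)], the tangents are independent wherever [D]
    is nonzero. *)
Lemma solution_jacobian t x1 x2 : B t x1 x2 ->
  J t x1 x2 = - (q t x1 x2 * E (Z Usig) t x1 x2 * D t x1 x2).
Proof.
intros Hq. destruct (solution_frame _ _ _ Hq) as [_ [_ [HX HY]]].
unfold J, D. rewrite HX, HY. ring.
Qed.

(** The second fundamental form, measured along the normal [(a, b, 1)]. *)
Lemma solution_second_form i j t x1 x2 : B t x1 x2 ->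
  - (d (axis_of j) Ua t x1 x2 * d (axis_of i) UX t x1 x2
     + d (axis_of j) Ub t x1 x2 * d (axis_of i) UY t x1 x2)
  = match i, j with i1, i1 => L | i2, i2 => N | _, _ => M end t x1 x2
    * J t x1 x2 * w t x1 x2.
Proof.
intros Hq. rewrite solution_jacobian by exact Hq.
assert (HN := solution_inv_N _ _ _ Hq). assert (Hs := solution_sigma _ _ _ Hq).
fold (N t x1 x2) in HN. fold (w t x1 x2) in Hs.
destruct (solution_frame _ _ _ Hq) as [Ha [Hb [HX HY]]].
assert (Hs' : forall x, x * - (q t x1 x2 * E (Z Usig) t x1 x2 * D t x1 x2) * w t x1 x2
  = - (x * q t x1 x2 * D t x1 x2)).
{ intros x. transitivity (- (x * q t x1 x2 * D t x1 x2)
    * (E (Z Usig) t x1 x2 * w t x1 x2)); [ring|]. rewrite Hs. ring. }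
rewrite Hs'. fold (q t x1 x2) in HN.
destruct i, j; simpl axis_of; rewrite ?Ha, ?Hb, ?HX, ?HY; unfold D.
- set (s := E (Z Usig) t x1 x2) in *. set (W := w t x1 x2) in *.
  unfold G. set (l := L t x1 x2). set (m := M t x1 x2). set (Q := q t x1 x2).
  set (A := d ax2 Ua t x1 x2). set (B0 := d ax2 Ub t x1 x2).
  set (X := d ax2 UX t x1 x2). set (Y := d ax2 UY t x1 x2).
  transitivity (- (Q ^ 2 * m ^ 2 * (A * X + B0 * Y)
    + (s * W) * (l - m ^ 2 * Q) * Q * (A * X + B0 * Y))); [ring|].
  rewrite Hs. ring.
- ring.
- ring.
- rewrite (Rmult_comm (N t x1 x2)), HN. ring.
Qed.

Hypothesis (PD : forall t x1 x2, B t x1 x2 -> D t x1 x2 < 0).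

Let at_ (a : idx -> coord -> field) t x1 x2 i c := a i c t x1 x2.
Let m t x1 x2 := cross (at_ y t x1 x2 i1) (at_ y t x1 x2 i2).

Lemma solution_normal_sqr t x1 x2 : B t x1 x2 ->
  dot (m t x1 x2) (m t x1 x2) = J t x1 x2 ^ 2 * w t x1 x2.
Proof.
intros Hq. unfold m, dot, cross, at_. rewrite !y_3 by exact Hq.
unfold J, w, y, d. simpl tangent. simpl axis_of. ring.
Qed.

Lemma solution_normal_pos t x1 x2 : B t x1 x2 -> 0 < dot (m t x1 x2) (m t x1 x2).
Proof.
intros Hq. rewrite solution_normal_sqr by exact Hq.
assert (Hs := solution_sigma _ _ _ Hq).
assert (P1 := PZ Usig _ _ _ I Hq). assert (P2 := PZ Uq _ _ _ I Hq).
assert (P3 := PD _ _ _ Hq).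
assert (HJ : 0 < J t x1 x2).
{ rewrite solution_jacobian by exact Hq. unfold q.
  assert (0 < E (Z Uq) t x1 x2 * E (Z Usig) t x1 x2) by (now apply Rmult_lt_0_compat).
  nra. }
apply Rmult_lt_0_compat; [now apply pow_lt|]. unfold w. nra.
Qed.

Lemma solution_surface (V : region) (g : metric) (L' M' N' : field) :
  open V -> (forall t x1 x2, V (t, x1, x2) -> B t x1 x2) ->
  (forall i j, g i j = E (jet_metric i j)) ->
  (forall t x1 x2, V (t, x1, x2) ->
     L' t x1 x2 = L t x1 x2 /\ M' t x1 x2 = M t x1 x2 /\ N' t x1 x2 = N t x1 x2) ->
  forall t x1 x2, V (t, x1, x2) -> gauss_codazzi_at g L' M' N' t x1 x2.
Proof.
intros HV HVB Hg Hh.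
apply (surface_gauss_codazzi V y yy yyy); auto.
- intros. apply E_pd; [auto|apply conv_tangent].
- intros. apply E_pd; [auto|apply conv_shift, conv_tangent].
- intros c t x1 x2 Hq. apply HVB in Hq. destruct c.
  + unfold yy. simpl tangent. now rewrite shift_comm.
  + unfold yy. simpl tangent. now rewrite shift_comm.
  (* Here the form [-(a dX + b dY)] is seen to be closed at fixed time: [a_2 X_1 + b_2 Y_1] and
     [a_1 X_2 + b_1 Y_2] both equal [- M J w]. *)
  + assert (H12 := solution_second_form i1 i2 _ _ _ Hq).
    assert (H21 := solution_second_form i2 i1 _ _ _ Hq).
    rewrite !yy_3 by exact Hq. simpl axis_of in *.
    replace (yy i2 i1 co1) with (yy i1 i2 co1)
      by (unfold yy; simpl tangent; now rewrite shift_comm).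
    replace (yy i2 i1 co2) with (yy i1 i2 co2)
      by (unfold yy; simpl tangent; now rewrite shift_comm).
    change (y i1 co1) with (d ax1 UX). change (y i1 co2) with (d ax1 UY).
    change (y i2 co1) with (d ax2 UX). change (y i2 co2) with (d ax2 UY). lra.
- assert (T : forall h f, (forall t x1 x2, V (t, x1, x2) ->
    h t x1 x2 = E f t x1 x2) -> conv r f ->
    forall e t x1 x2, V (t, x1, x2) -> ex_pd (axis_of e) h t x1 x2).
  { intros h f Hhf Hf e t x1 x2 Hq. eexists.
    apply (open_is_pd_ext V _ (E f)); auto.
    - intros; symmetry; auto.
    - apply E_pd; auto. }
  assert (CL : conv r (jL rho v Z)) by (unfold jL; conv_tac).
  assert (CM : conv r (jM rho u v)) by (unfold jM; conv_tac).
  assert (CN : conv r (jN rho u Z)) by (unfold jN; conv_tac).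
  intros i j e t x1 x2 Hq. destruct i, j.
  + apply (T _ (jL rho v Z)); auto. clear t x1 x2 Hq; intros t x1 x2 Hq.
    destruct (Hh _ _ _ Hq) as [-> _]. apply HVB in Hq. unfold jL. E_simpl Hq. unfold L. ring.
  + apply (T _ (jM rho u v)); auto. clear t x1 x2 Hq; intros t x1 x2 Hq.
    destruct (Hh _ _ _ Hq) as [_ [-> _]]. apply HVB in Hq. unfold jM. E_simpl Hq. unfold M. ring.
  + apply (T _ (jM rho u v)); auto. clear t x1 x2 Hq; intros t x1 x2 Hq.
    destruct (Hh _ _ _ Hq) as [_ [-> _]]. apply HVB in Hq. unfold jM. E_simpl Hq. unfold M. ring.
  + apply (T _ (jN rho u Z)); auto. clear t x1 x2 Hq; intros t x1 x2 Hq.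
    destruct (Hh _ _ _ Hq) as [_ [_ ->]]. apply HVB in Hq. unfold jN. E_simpl Hq. unfold N. ring.
- intros i j t x1 x2 Hq. apply HVB in Hq. rewrite Hg. unfold jet_metric.
  assert (C := conv_tangent).
  rewrite !E_add, !E_mul by (auto; repeat apply conv_jadd; apply conv_jmul; auto).
  unfold dot, y. ring.
- intros t x1 x2 Hq. now apply solution_normal_pos, HVB.
- intros i j t x1 x2 Hq. destruct (Hh _ _ _ Hq) as [HL [HM HN]].
  apply HVB in Hq. fold (at_ y t x1 x2). fold (m t x1 x2).
  change (cross _ _) with (m t x1 x2).
  assert (S := solution_second_form i j _ _ _ Hq).
  rewrite solution_normal_sqr by exact Hq.
  (* With [n = (a, b, 1)] and [m = J n], differentiating [y_i . n = 0] gives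
     [y_ij . m = - J (y_i . n_j)], where [n_j = (a_j, b_j, 0)]. *)
  transitivity (- J t x1 x2 * (d (axis_of j) Ua t x1 x2 * d (axis_of i) UX t x1 x2
     + d (axis_of j) Ub t x1 x2 * d (axis_of i) UY t x1 x2)).
  + unfold m, dot, cross, at_. rewrite yy_3, !y_3 by exact Hq.
    change (y i co1) with (d (axis_of i) UX). change (y i co2) with (d (axis_of i) UY).
    unfold J, y, d. simpl tangent. simpl axis_of. ring.
  + rewrite <- Ropp_mult_distr_l, Ropp_mult_distr_r, S.
    destruct i, j; rewrite ?HL, ?HM, ?HN; ring.
Qed.

Lemma solution_metric (V : region) (g : metric) :
  open V -> (forall t x1 x2, V (t, x1, x2) -> B t x1 x2) ->
  (forall i j, g i j = E (jet_metric i j)) -> evolving_metric V g.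
Proof.
intros HV HVB Hg.
assert (Gdot : forall i j t x1 x2, V (t, x1, x2) ->
  g i j t x1 x2 = dot (at_ y t x1 x2 i) (at_ y t x1 x2 j)).
{ intros i j t x1 x2 Hq. apply HVB in Hq. rewrite Hg. unfold jet_metric.
  assert (C := conv_tangent).
  rewrite !E_add, !E_mul by (auto; repeat apply conv_jadd; apply conv_jmul; auto).
  unfold dot, at_, y. ring. }
split.
- intros i j n. rewrite Hg.
  apply (jfield_Cn_on r a1 a2 V HV) with (jet_metric i j); auto.
  apply conv_jet_metric.
- intros t x1 x2 Hq. split.
  + intros i j. rewrite !Gdot by exact Hq. unfold dot. ring.
  + intros z [i Hz]. unfold sum_idx. rewrite !Gdot by exact Hq.
    assert (Hm := solution_normal_pos _ _ _ (HVB _ _ _ Hq)). unfold m in Hm.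
    set (Y1 := at_ y t x1 x2 i1) in *. set (Y2 := at_ y t x1 x2 i2) in *.
    set (A := fun c => z i1 * Y1 c + z i2 * Y2 c).
    assert (E0 : dot Y1 Y1 * z i1 * z i1 + dot Y1 Y2 * z i1 * z i2
      + (dot Y2 Y1 * z i2 * z i1 + dot Y2 Y2 * z i2 * z i2) = dot A A).
    { unfold dot, A. ring. }
    rewrite E0.
    (* Lagrange's identity, with [A x Y2 = z1 (Y1 x Y2)] and, in [E2], [A x Y1 = - z2 (Y1 x Y2)]: if
       [A] vanishes, so do both coefficients. *)
    assert (E1 : dot A A * dot Y2 Y2
      = dot A Y2 ^ 2 + z i1 ^ 2 * dot (cross Y1 Y2) (cross Y1 Y2)).
    { unfold dot, cross, A. ring. }
    assert (E2 : dot A A * dot Y1 Y1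
      = dot A Y1 ^ 2 + z i2 ^ 2 * dot (cross Y1 Y2) (cross Y1 Y2)).
    { unfold dot, cross, A. ring. }
    assert (P0 : 0 <= dot A A) by (unfold dot; nra).
    destruct (Rle_lt_or_eq_dec _ _ P0) as [|Heq]; [assumption|exfalso].
    rewrite <- Heq, Rmult_0_l in E1, E2.
    assert (Q1 := pow2_ge_0 (dot A Y2)). assert (Q2 := pow2_ge_0 (dot A Y1)).
    assert (R1 : 0 < z i ^ 2) by (now apply pow2_gt_0).
    destruct i; nra.
Qed.

End Solution.

(** * The neighbourhood and the conclusion *)

Lemma box_open a1 a2 eps :
  open (fun q : R * R * R => box a1 a2 eps (fst (fst q)) (snd (fst q)) (snd q)).
Proof.
assert (T : forall (p : R * R * R -> R) a, (forall q, continuous p q) ->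
  open (fun q => Rabs (p q - a) < eps)).
{ intros p a Hp. apply (open_comp (fun q => Rabs (p q - a)) (fun z => z < eps)).
  - intros q _. apply (continuous_comp (fun q => p q - a) Rabs).
    + apply (continuous_minus (V := R_NormedModule)); [apply Hp|apply continuous_const].
    + apply continuous_Rabs.
  - apply open_lt. }
apply open_and; [|apply open_and].
- apply (open_ext (fun q : R * R * R => Rabs (fst (fst q) - 0) < eps)).
  { intros q. now rewrite Rminus_0_r. }
  apply T. intros q. apply continuous_comp; apply continuous_fst.
- apply T. intros q. apply continuous_comp; [apply continuous_fst|apply continuous_snd].
- apply T. intros q. apply continuous_snd.
Qed.

Theorem corollary8p1 (gamma : R) (rho u v : field) (a1 a2 : R) (U : region)
  (hgamma : 1 <= gamma)
  (hU : open U) (h0U : U (0, a1, a2))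
  (hsol : analytic_euler_solution gamma U rho u v)
  (hinit : rho 0 a1 a2 * u 0 a1 a2 * v 0 a1 a2 <> 0) :
  exists (V : region) (g : metric),
    open V /\ V (0, a1, a2) /\ (forall q, V q -> U q) /\
    defines_immersed_evolving_manifold gamma V rho u v g /\
    (forall t x1 x2, V (t, x1, x2) -> 0 <= t ->
       gauss_curvature g t x1 x2
       = Rpower (rho t x1 x2) (2 * gamma) / gamma ^ 2
         + (u t x1 x2 ^ 2 + v t x1 x2 ^ 2)
           * (Rpower (rho t x1 x2) (gamma + 1) / gamma)).
Proof.
destruct hsol as [Arho [Au [Av Hsol]]].
destruct (Hsol 0 a1 a2 h0U (Rle_refl 0)) as [Hrho0 _].
destruct (analytic_at_jet _ _ _ _ (Arho _ _ _ h0U))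
  as [jr [s1 [C1 [M1 [Hs1 [HC1 [HM1 [B1 Er]]]]]]]].
destruct (analytic_at_jet _ _ _ _ (Au _ _ _ h0U))
  as [ju [s2 [C2 [M2 [Hs2 [HC2 [HM2 [B2 Eu]]]]]]]].
destruct (analytic_at_jet _ _ _ _ (Av _ _ _ h0U))
  as [jv [s3 [C3 [M3 [Hs3 [HC3 [HM3 [B3 Ev]]]]]]]].
assert (Hgamma : 0 < gamma) by lra.
destruct (system_solution gamma jr ju jv (4 * (M1 + M2 + M3)))
  as [Z [r [Hr [Cr [Cu [Cv [CZ [Z0 [Z1 [Z2 Zt]]]]]]]]]]; [lra| | | |].
{ apply (dominated_phi C1 M1); auto; lra. }
{ apply (dominated_phi C2 M2); auto; lra. }
{ apply (dominated_phi C3 M3); auto; lra. }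
assert (Zero : forall s, 0 < s -> Rabs 0 < s) by (intros; rewrite Rabs_R0; lra).
assert (Jr0 : 0 < jr O O O).
{ rewrite <- (jfield_center a1 a2 jr). rewrite Er, Rminus_0_r in Hrho0; auto;
    rewrite Rminus_diag; auto. }
assert (Pw : 0 < Rpower (jr O O O) gamma / gamma).
{ apply Rdiv_lt_0_compat; [apply exp_pos|exact Hgamma]. }
(* This is [- D]. At the centre the Cauchy data give [a_2 = 1], [X_2 = -1] and [b_2 = Y_2 = 0], so
   its value there is 1. *)
pose (jD := jscal (-1) (jadd (jmul (shift ax2 (Z Ua)) (shift ax2 (Z UX)))
                             (jmul (shift ax2 (Z Ub)) (shift ax2 (Z UY))))).
assert (CD1 : conv r (jmul (shift ax2 (Z Ua)) (shift ax2 (Z UX))))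
  by (apply conv_jmul; apply conv_shift, CZ).
assert (CD2 : conv r (jmul (shift ax2 (Z Ub)) (shift ax2 (Z UY))))
  by (apply conv_jmul; apply conv_shift, CZ).
assert (L0 : locally (0, a1, a2) U) by (apply hU, h0U).
assert (L1 := jfield_pos_near a1 a2 r jr Hr Cr Jr0).
assert (L2 : locally (0, a1, a2) (fun q : R * R * R =>
  0 < jfield a1 a2 (Z Us) (fst (fst q)) (snd (fst q)) (snd q))).
{ apply (jfield_pos_near a1 a2 r); auto. rewrite Z0. simpl.
  now apply Rinv_0_lt_compat. }
assert (L3 : locally (0, a1, a2) (fun q : R * R * R =>
  0 < jfield a1 a2 (Z Up) (fst (fst q)) (snd (fst q)) (snd q))).
{ apply (jfield_pos_near a1 a2 r); auto. rewrite Z0. exact Pw. }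
assert (L4 : locally (0, a1, a2) (fun q : R * R * R =>
  0 < jfield a1 a2 (Z Uq) (fst (fst q)) (snd (fst q)) (snd q))).
{ apply (jfield_pos_near a1 a2 r); auto. rewrite Z0. simpl.
  apply Rinv_0_lt_compat. nra. }
assert (L5 : locally (0, a1, a2) (fun q : R * R * R =>
  0 < jfield a1 a2 (Z Usig) (fst (fst q)) (snd (fst q)) (snd q))).
{ apply (jfield_pos_near a1 a2 r); auto. rewrite Z0. simpl. lra. }
assert (L6 : locally (0, a1, a2) (fun q : R * R * R =>
  0 < jfield a1 a2 jD (fst (fst q)) (snd (fst q)) (snd q))).
{ apply (jfield_pos_near a1 a2 r); auto.
  - unfold jD. now apply conv_jscal, conv_jadd.
  - unfold jD, jscal, jadd. simpl. rewrite !Z2. simpl. lra. }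
destruct (filter_and _ _ L0 (filter_and _ _ L1 (filter_and _ _ L2
  (filter_and _ _ L3 (filter_and _ _ L4 (filter_and _ _ L5 L6))))))
  as [e0 He0].
(* [e0] secures the inclusion in [U] and the signs, [r / 3] the convergence of all the jets (the
   norm adds three coordinates), and [s1], [s2], [s3] the expansions of [rho], [u], [v]. *)
set (eps := Rmin (Rmin e0 (r / 3)) (Rmin s1 (Rmin s2 s3))).
assert (Heps : 0 < eps).
{ assert (He := cond_pos e0). repeat apply Rmin_glb_lt; lra. }
assert (Le0 : eps <= e0) by (unfold eps; eapply Rle_trans; [apply Rmin_l|apply Rmin_l]).
assert (Ler : 3 * eps <= r).
{ assert (eps <= r / 3) by (unfold eps; eapply Rle_trans; [apply Rmin_l|apply Rmin_r]).
  lra. }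
assert (Les : eps <= Rmin s1 (Rmin s2 s3)) by apply Rmin_r.
assert (Le1 := Rmin_l s1 (Rmin s2 s3)). assert (Le23 := Rmin_r s1 (Rmin s2 s3)).
assert (Le2 := Rmin_l s2 s3). assert (Le3 := Rmin_r s2 s3).
assert (Near : forall t x1 x2, box a1 a2 eps t x1 x2 -> ball (0, a1, a2) e0 (t, x1, x2)).
{ intros t x1 x2 [Ht [H1 H2]].
  assert (Bl : forall a x, Rabs (x - a) < eps -> ball (a : R) e0 x)
    by (intros a x Hx; change (Rabs (x - a) < e0); lra).
  split; [split|]; apply Bl; simpl; try assumption. now rewrite Rminus_0_r. }
assert (Fr : forall t x1 x2, box a1 a2 eps t x1 x2 -> rho t x1 x2 = jfield a1 a2 jr t x1 x2).
{ intros t x1 x2 [Ht [H1 H2]]. rewrite Er, Rminus_0_r; rewrite ?Rminus_0_r; auto; lra. }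
assert (Fu : forall t x1 x2, box a1 a2 eps t x1 x2 -> u t x1 x2 = jfield a1 a2 ju t x1 x2).
{ intros t x1 x2 [Ht [H1 H2]]. rewrite Eu, Rminus_0_r; rewrite ?Rminus_0_r; auto; lra. }
assert (Fv : forall t x1 x2, box a1 a2 eps t x1 x2 -> v t x1 x2 = jfield a1 a2 jv t x1 x2).
{ intros t x1 x2 [Ht [H1 H2]]. rewrite Ev, Rminus_0_r; rewrite ?Rminus_0_r; auto; lra. }
assert (Prho : forall t x1 x2, box a1 a2 eps t x1 x2 -> 0 < jfield a1 a2 jr t x1 x2).
{ intros t x1 x2 Hq. apply (He0 _ (Near _ _ _ Hq)). }
assert (PZ : forall m t x1 x2,
  match m with Us | Up | Uq | Usig => True | _ => False end ->
  box a1 a2 eps t x1 x2 -> 0 < jfield a1 a2 (Z m) t x1 x2).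
{ intros m t x1 x2 Hm Hq. destruct (He0 _ (Near _ _ _ Hq)) as (_ & _ & Q1 & Q2 & Q3 & Q4 & _).
  destruct m; easy. }
assert (PD : forall t x1 x2, box a1 a2 eps t x1 x2 ->
  jfield a1 a2 (shift ax2 (Z Ua)) t x1 x2 * jfield a1 a2 (shift ax2 (Z UX)) t x1 x2
  + jfield a1 a2 (shift ax2 (Z Ub)) t x1 x2 * jfield a1 a2 (shift ax2 (Z UY)) t x1 x2 < 0).
{ intros t x1 x2 Hq. destruct (He0 _ (Near _ _ _ Hq)) as (_ & _ & _ & _ & _ & _ & Q).
  simpl in Q. unfold jD in Q.
  assert (Hd := dist1_box _ _ _ r _ _ _ Ler Hq).
  rewrite jfield_scal, (jfield_add a1 a2 r), !(jfield_mul a1 a2 r) in Q; auto;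
    try (apply conv_shift, CZ). lra. }
set (V := fun q : R * R * R => box a1 a2 eps (fst (fst q)) (snd (fst q)) (snd q)).
set (g := fun i j => jfield a1 a2 (jet_metric Z i j)).
assert (HV : open V) by apply box_open.
assert (Press : forall t x1 x2, V (t, x1, x2) ->
  jfield a1 a2 (Z Up) t x1 x2 = pressure gamma rho t x1 x2).
{ intros t x1 x2 Hq. unfold pressure. rewrite Fr by exact Hq.
  now apply (solution_pressure gamma jr ju jv Z r eps). }
assert (GC : forall t x1 x2, V (t, x1, x2) ->
  gauss_codazzi_at g (fluid_L gamma rho v) (fluid_M rho u v) (fluid_N gamma rho u) t x1 x2).
{ apply (solution_surface gamma jr ju jv Z r eps a1 a2 Heps Ler Cr Cu Cv CZ Z0 Z1 Z2 Zt
    PZ PD V g); auto.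
  intros t x1 x2 Hq. unfold fluid_L, fluid_M, fluid_N. rewrite <- Press by exact Hq.
  now rewrite Fr, Fu, Fv by exact Hq. }
exists V, g. split; [exact HV|]. split; [|split; [|split]].
- unfold V, box. simpl. rewrite !Rminus_diag. auto.
- intros [[t x1] x2] Hq. apply (He0 _ (Near _ _ _ Hq)).
- split.
  + apply (solution_metric gamma jr ju jv Z r eps a1 a2 Heps Ler Cr Cu Cv CZ Z0 Z1 Z2 Zt
      PZ PD V g); auto.
  + intros t x1 x2 Hq _. now apply GC.
(* By the Gauss equation the curvature is [L N - M^2], where [rho^2 u^2 v^2] cancels and
   [p^2 + rho p (u^2 + v^2)] remains. *)
- intros t x1 x2 Hq _. destruct (GC _ _ _ Hq) as [_ [_ <-]].
  assert (P := Prho _ _ _ Hq). rewrite <- Fr in P by exact Hq.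
  unfold fluid_L, fluid_M, fluid_N, pressure.
  replace (2 * gamma) with (gamma + gamma) by ring.
  rewrite !Rpower_plus, Rpower_1 by exact P. field. lra.
Qed.
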